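(* Let $A\in\mathbb M_{N\times N}$, $B=(b_1,\dots,b_M)\in\mathbb M_{N\times M}$ with $1\le M\le N$, $N\ge2$, such that $\mathrm{rank}[b_i,Ab_i,\dots,A^{N-1}b_i]=N$ for each $i=1,\dots,M$, and $k:=\mathrm{rank}B<N$. Let $T$ be the minimum time function to reach the origin for $\dot x=Ax+Bu$, $u\in[-1,1]^M$, and let $$\mathcal S=\Big\{x\in\mathbb R^N:\ \exists\, r>0,\ \zeta\in\mathbb S^{N-1}\text{ with } x=\sum_{i=1}^M\int_0^r e^{A(t-r)}b_i\,\mathrm{sign}(\langle\zeta,e^{At}b_i\rangle)\,dt\ \text{ and }\ \langle\zeta,b_i\rangle=0\ \forall i=1,\dots,M\Big\}.$$ Let $\bar x\in\mathbb R^N\setminus\{0\}$. Then $T$ is non-Lipschitz at $\bar x$ if and only if $\bar x\in\mathcal S$. Moreover, $\mathcal S$ is invariant for optimal trajectories of the reversed dynamics $\dot x=-Ax-Bu$, $u\in[-1,1]^M$, $x(0)=0$, having vanishing minimized Hamiltonian.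
   Context: $T(x)$ is the infimum of times $\theta\ge0$ such that some measurable control $u:[0,\theta]\to[-1,1]^M$ steers $x$ to $0$ along $\dot y=Ay+Bu$; $\mathcal R_t=\{T\le t\}$. The minimized Hamiltonian is $h(x,\zeta)=\langle\zeta,Ax\rangle+\min_{u\in[-1,1]^M}\langle\zeta,Bu\rangle$; an optimal trajectory of the reversed dynamics from the origin has vanishing Hamiltonian if it admits an adjoint vector $\lambda(\cdot)$ (as in Pontryagin's Maximum Principle, with terminal value a proximal normal to the sublevel set $\mathcal R_t$ at the endpoint) along which $h$ vanishes. $T$ is non-Lipschitz at $x$ if there exist sequences $x_i\to x$, $y_i\to x$, $x_i\neq y_i$, with $\limsup_i |T(y_i)-T(x_i)|/\|y_i-x_i\|=+\infty$.
   Formalization: The equivalence is stated for nonzero x̄ with T(x̄) < +∞: at boundary points of the reachable set (e.g. A=diag(1,2), b=(1,1), x̄=(1,1/2)) T blows up, so it is non-Lipschitz though x̄ is not in S, and outside its closure the difference quotient is undefined. Invariance means forward in time. *)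

(* Defs.v *)
From HB Require Import structures.
From mathcomp Require Import all_boot all_order all_algebra.
From mathcomp Require Import all_classical all_reals all_analysis.

Set Implicit Arguments.
Unset Strict Implicit.
Unset Printing Implicit Defensive.

Import Order.TTheory GRing.Theory Num.Theory.
Import numFieldNormedType.Exports.
Local Open Scope classical_set_scope.
Local Open Scope ring_scope.

Section Defs.
Variable R : realType.

Definition expm (n : nat) (A : 'M[R]_n) (t : R) : 'M[R]_n :=
  limn (series (fun k : nat => (t ^+ k / (k`!)%:R) *: (A ^+ k))).

Definition dotv (n : nat) (x y : 'cV[R]_n) : R := \sum_(j < n) x j 0 * y j 0.

Definition vint (n : nat) (a b : R) (f : R -> 'cV[R]_n) : 'cV[R]_n :=
  \col_(j < n) Rintegral lebesgue_measure `[a, b] (fun t => f t j 0).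

Definition admissible (M : nat) (theta : R) (u : R -> 'cV[R]_M) : Prop :=
  (forall j : 'I_M, measurable_fun `[0, theta] (fun t => u t j 0)) /\
  (forall t, 0 <= t <= theta -> forall j : 'I_M, -1 <= u t j 0 <= 1).

(** Solution at time θ of  y' = A y + B u,  y(0) = x  (variation of constants). *)
Definition fwd_sol (N M : nat) (A : 'M[R]_N) (B : 'M[R]_(N, M))
  (u : R -> 'cV[R]_M) (x : 'cV[R]_N) (theta : R) : 'cV[R]_N :=
  expm A theta *m x + vint 0 theta (fun s => expm A (theta - s) *m (B *m u s)).

(** Minimum time function (value +oo when the origin cannot be reached). *)
Definition min_time (N M : nat) (A : 'M[R]_N) (B : 'M[R]_(N, M))
  (x : 'cV[R]_N) : \bar R :=
  ereal_inf [set (theta%:E)%E | theta in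
    [set theta : R | 0 <= theta /\
       exists u, admissible theta u /\ fwd_sol A B u x theta = 0]].

Definition sublevel (N M : nat) (A : 'M[R]_N) (B : 'M[R]_(N, M)) (t : R)
  : set 'cV[R]_N := [set x | (min_time A B x <= t%:E)%E].

Definition non_lipschitz_at (N : nat) (f : 'cV[R]_N -> \bar R) (x : 'cV[R]_N)
  : Prop :=
  exists xs ys : nat -> 'cV[R]_N,
    xs @ \oo --> x /\ ys @ \oo --> x /\ (forall i, xs i != ys i) /\
    limn_esup (fun i => (`|f (ys i) - f (xs i)| *
                         (`|ys i - xs i|^-1)%:E)%E) = +oo%E.

Definition setS (N M : nat) (A : 'M[R]_N) (B : 'M[R]_(N, M)) : set 'cV[R]_N :=
  [set x | exists r : R, exists zeta : 'cV[R]_N,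
     0 < r /\ dotv zeta zeta = 1 /\
     x = \sum_(i < M) vint 0 r (fun t =>
            Num.sg (dotv zeta (expm A t *m col i B)) *: (expm A (t - r) *m col i B)) /\
     (forall i : 'I_M, dotv zeta (col i B) = 0)].

Definition cube (M : nat) : set 'cV[R]_M :=
  [set w | forall j : 'I_M, -1 <= w j 0 <= 1].

Definition ham_min (N M : nat) (A : 'M[R]_N) (B : 'M[R]_(N, M))
  (x zeta : 'cV[R]_N) : R :=
  dotv zeta (A *m x) + inf [set dotv zeta (B *m w) | w in @cube M].

(** Trajectory of the reversed dynamics  y' = -A y - B u,  y(0) = 0. *)
Definition rev_sol (N M : nat) (A : 'M[R]_N) (B : 'M[R]_(N, M))
  (u : R -> 'cV[R]_M) (t : R) : 'cV[R]_N :=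
  - vint 0 t (fun s => expm A (s - t) *m (B *m u s)).

Definition proximal_normal (N : nat) (K : set 'cV[R]_N) (x nu : 'cV[R]_N) : Prop :=
  exists sigma : R, 0 <= sigma /\
    forall y, K y -> dotv nu (y - x) <= sigma * dotv (y - x) (y - x).

Definition rev_optimal (N M : nat) (A : 'M[R]_N) (B : 'M[R]_(N, M))
  (theta : R) (u : R -> 'cV[R]_M) : Prop :=
  0 <= theta /\ admissible theta u /\ min_time A B (rev_sol A B u theta) = theta%:E.

(** The optimal trajectory admits an adjoint vector λ(t) = e^{A^T (t-θ)} ν
    (λ' = A^T λ, λ(θ) = ν a nonzero proximal normal to R_θ at the endpoint,
    with the minimum condition of the PMP a.e.) along which h vanishes. *)
Definition vanishing_hamiltonian (N M : nat) (A : 'M[R]_N) (B : 'M[R]_(N, M))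
  (theta : R) (u : R -> 'cV[R]_M) : Prop :=
  exists nu : 'cV[R]_N,
    nu != 0 /\
    proximal_normal (sublevel A B theta) (rev_sol A B u theta) nu /\
    let lambda := fun t => expm A^T (t - theta) *m nu in
    {ae lebesgue_measure, forall t, 0 <= t <= theta ->
       dotv (lambda t) (B *m u t) = inf [set dotv (lambda t) (B *m w) | w in @cube M]} /\
    (forall t, 0 <= t <= theta -> ham_min A B (rev_sol A B u t) (lambda t) = 0).

Definition kalman (N : nat) (A : 'M[R]_N) (b : 'cV[R]_N) : 'M[R]_N :=
  \matrix_(r < N, j < N) (A ^+ j *m b) r 0.

End Defs.

(* Main.v *)
Require Import Defs.
From HB Require Import structures.
From mathcomp Require Import all_boot all_order all_algebra.
From mathcomp Require Import all_classical all_reals all_analysis.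
From mathcomp Require Import measurable_realfun ring lra.
Set Implicit Arguments.
Unset Strict Implicit.
Unset Printing Implicit Defensive.
Import Order.TTheory GRing.Theory Num.Theory.
Import numFieldNormedType.Exports.
Local Open Scope classical_set_scope.
Local Open Scope ring_scope.

(** A control [u] steers [x] to the origin in time [theta] iff
    [x = - \int_0^theta e^{-As} B u(s) ds]; the convex set [reach theta] of such
    points has support function
    [support z theta = \sum_j \int_0^theta |<z, e^{-As} b_j>| ds], attained at the
    bang-bang point [extremal z theta]. Under the Kalman condition the switching
    functions [s |-> <z, e^{-As} b_j>] have countably many zeros when [z != 0].
    Hence the maximizer of [z] over the closure of [reach theta] is unique, and
    the controllability Gramian is invertible, so that [T x <= theta] iff [x] is
    in that closure and [T] is continuous where it is finite. In these terms [S]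
    consists of the points [extremal z r] with [z != 0], [r > 0] and all switching
    functions of [z] vanishing at [r], i.e. those for which the
    [theta]-derivative of [support z] vanishes at [r].

    If [x = extremal z r] lies in [S], then [x + h z] in [reach (r + k h)] would
    give [h <z, z> <= support z (r + k h) - support z r = o(h)], so [T] has
    infinite slope at [x] in the direction [z].

    Conversely, let [T p - T q > k |p - q|] with [p, q] close to [x]. A unit
    vector [z] separating [p] from a slightly smaller reachable set satisfies
    [support z theta - support z t <= <z, p - q>] with [theta - t] equal to
    [(T p - T q) / 3], hence [\sum_j |<z, e^{-Ar} b_j>| = O(1/k)] for [r = T x].
    A limit of such [z] exhibits [x] as a point of [S].

    Along a trajectory with vanishing Hamiltonian, evaluating [h] at time [0]
    gives [<lambda(0), b_j> = 0], and the minimum condition identifies the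
    control with [- sign <lambda(0), e^{As} b_j>] almost everywhere, so the
    whole trajectory after time [0] lies in [S]. *)

Section MatrixCalculus.
Variable R : realFieldType.

Lemma mx_norm_leP (m n : nat) (x : 'M[R]_(m, n)) c :
  0 <= c -> `|x| <= c <-> forall i j, `|x i j| <= c.
Proof.
move=> c0; rewrite [`|x|]/Num.Def.normr/= mx_normrE; split=> [xc i j|xc].
  by apply: le_trans xc; exact: (le_bigmax _ (fun ij => `|x ij.1 ij.2|) (i, j)).
by apply: bigmax_le => // -[i j] _; exact: xc.
Qed.

Lemma norm_coord_le (m n : nat) (x : 'M[R]_(m, n)) i j : `|x i j| <= `|x|.
Proof. exact: (mx_norm_leP x (normr_ge0 x)).1. Qed.

Lemma norm_trmx (m n : nat) (x : 'M[R]_(m, n)) : `|x^T| = `|x|.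
Proof.
apply/eqP; rewrite eq_le; apply/andP; split; apply/mx_norm_leP => // i j.
  by rewrite mxE norm_coord_le.
by have := norm_coord_le x^T j i; rewrite mxE.
Qed.

Lemma mulmx_norm_le (m n p : nat) (x : 'M[R]_(m, n)) (y : 'M[R]_(n, p)) :
  `|x *m y| <= n%:R * `|x| * `|y|.
Proof.
apply/mx_norm_leP => [|i j]; first by rewrite !mulr_ge0.
rewrite mxE (le_trans (ler_norm_sum _ _ _))//.
apply: (@le_trans _ _ (\sum_(k < n) `|x| * `|y|)).
  by apply: ler_sum => k _; rewrite normrM ler_pM// norm_coord_le.
by rewrite sumr_const card_ord -[leLHS]mulr_natl mulrA.
Qed.

Lemma cvg_mxP (T : Type) (F : set_system T) {FF : Filter F} (m n : nat)
    (f : T -> 'M[R]_(m, n)) (l : 'M[R]_(m, n)) :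
  f @ F --> l <-> forall i j, f x i j @[x --> F] --> l i j.
Proof.
split=> [fl i j|fl]; apply/cvgrPdist_le => e e0.
  have /cvgrPdist_le/(_ e e0) := fl; apply: filterS => x /(le_trans _); apply.
  by have := norm_coord_le (l - f x) i j; rewrite !mxE.
have fl_e ij : \forall x \near F, `|l ij.1 ij.2 - f x ij.1 ij.2| <= e.
  by have /cvgrPdist_le/(_ e e0) := fl ij.1 ij.2.
apply: filterS (filter_forall FF fl_e) => x flx.
apply/mx_norm_leP => [|i j]; first exact: ltW.
by rewrite !mxE; exact: (flx (i, j)).
Qed.

Lemma cvg_mulmx (T : Type) (F : set_system T) {FF : Filter F} (m n p : nat)
    (f : T -> 'M[R]_(m, n)) (g : T -> 'M[R]_(n, p))
    (a : 'M[R]_(m, n)) (b : 'M[R]_(n, p)) :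
  f @ F --> a -> g @ F --> b -> f x *m g x @[x --> F] --> a *m b.
Proof.
move=> /cvg_mxP fa /cvg_mxP gb; apply/cvg_mxP => i j; rewrite mxE.
under eq_fun do rewrite mxE.
by apply: cvg_big => [|k _]; [exact: add_continuous|exact: cvgM].
Qed.

Lemma is_derive_mxP (V : normedModType R) (m n : nat) (f : V -> 'M[R]_(m, n))
    x v df :
  is_derive x v f df <-> forall i j, is_derive x v (fun y => f y i j) (df i j).
Proof.
split=> [[/[dup] drvf /derivable_mxP drv_coord <-] i j|drv_coord].
  by rewrite derive_mx// mxE; exact: DeriveDef.
have drvf : derivable f x v by apply/derivable_mxP => i j; case: (drv_coord i j).
apply: (DeriveDef drvf); rewrite derive_mx//.
by apply/matrixP => i j; rewrite mxE; case: (drv_coord i j).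
Qed.

Lemma is_derive_mulmx (V : normedModType R) (m n p : nat)
    (f : V -> 'M[R]_(m, n)) (g : V -> 'M[R]_(n, p)) x v df dg :
  is_derive x v f df -> is_derive x v g dg ->
  is_derive x v (fun y => f y *m g y) (df *m g x + f x *m dg).
Proof.
move=> /is_derive_mxP drvf /is_derive_mxP drvg; apply/is_derive_mxP => i j.
have -> : (fun y => (f y *m g y) i j) =
    \sum_k ((fun y => f y i k) * (fun y => g y k j)).
  by apply/funext => y; rewrite fct_sumE mxE.
have -> : (df *m g x + f x *m dg) i j =
    \sum_k (f x i k *: dg k j + g x k j *: df i k).
  rewrite !mxE -big_split; apply: eq_bigr => k _ /=.
  by rewrite addrC; congr (_ + _); rewrite mulrC.
by apply: is_derive_sum => k; exact: is_deriveM.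
Qed.

End MatrixCalculus.

Section MatrixExponential.
Variables (R : realType) (n : nat) (A : 'M[R]_n).

Lemma norm_expr_mx_le k i j :
  `|(A ^+ k) i j| <= (\sum_i \sum_j `|A i j|) ^+ k.
Proof.
set a := \sum_i _.
have row_ge0 i' : 0 <= \sum_j `|A i' j| by exact: sumr_ge0.
have a0 : 0 <= a by exact: sumr_ge0.
elim: k i j => [|k IH] i j.
  by rewrite !expr0 mxE; case: (i == j); rewrite ?normr1 ?normr0.
rewrite !exprS mxE (le_trans (ler_norm_sum _ _ _))//.
apply: (@le_trans _ _ ((\sum_j `|A i j|) * a ^+ k)).
  by rewrite mulr_suml ler_sum// => l _; rewrite normrM ler_wpM2l.
by rewrite ler_wpM2r ?exprn_ge0// [leRHS](bigD1 i)//= lerDl sumr_ge0.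
Qed.

Let expm_coeff p i j : R^nat := fun k => (A ^+ (k + p)) i j / k`!%:R.

Let is_cvg_expm_coeff p i j t : cvgn (pseries (expm_coeff p i j) t).
Proof.
set a := \sum_i \sum_j `|A i j|.
have a0 : 0 <= a by apply: sumr_ge0 => ? _; exact: sumr_ge0.
apply: normed_cvg.
apply: (@series_le_cvg _ _ (fun k => a ^+ p * exp_coeff (a * `|t|) k)) => [k|k|k|].
- exact: normr_ge0.
- by rewrite mulr_ge0 ?exprn_ge0// exp_coeff_ge0// mulr_ge0.
- rewrite /= /expm_coeff !normrM normrX normfV normr_nat /exp_coeff/= exprMn.
  have -> : a ^+ p * (a ^+ k * `|t| ^+ k / k`!%:R) =
      a ^+ (k + p) / k`!%:R * `|t| ^+ k by rewrite exprD; ring.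
  by rewrite !ler_wpM2r ?exprn_ge0 ?invr_ge0// norm_expr_mx_le.
- by apply: is_cvg_seriesZ; exact: is_cvg_series_exp_coeff.
Qed.

Let diffs_expm_coeff p i j : pseries_diffs (expm_coeff p i j) = expm_coeff p.+1 i j.
Proof.
apply/funext => k; rewrite /pseries_diffs /expm_coeff factS natrM addSnnS.
by rewrite invfM mulrCA [_%:R * _]mulrA divff ?mul1r// pnatr_eq0.
Qed.

Lemma cvg_expm t :
  series (fun k => (t ^+ k / k`!%:R) *: A ^+ k) @ \oo --> expm A t.
Proof.
apply/cvg_ex; exists (\matrix_(i, j) limn (pseries (expm_coeff 0 i j) t)).
apply/cvg_mxP => i j; rewrite mxE.
rewrite (_ : (fun k => _) = pseries (expm_coeff 0 i j) t).
  exact: is_cvg_expm_coeff.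
apply/funext => k; rewrite /pseries /series/= summxE; apply: eq_bigr => l _.
by rewrite mxE /expm_coeff addn0; ring.
Qed.

Lemma expm_comm t : A *m expm A t = expm A t *m A.
Proof.
pose S := series (fun k => (t ^+ k / k`!%:R) *: A ^+ k).
have cvgS : S k @[k --> \oo] --> expm A t := @cvg_expm t.
have cvgAS : A *m S k @[k --> \oo] --> A *m expm A t.
  by apply: cvg_mulmx => //; exact: cvg_cst.
have cvgSA : S k *m A @[k --> \oo] --> expm A t *m A.
  by apply: cvg_mulmx => //; exact: cvg_cst.
suff AS_SA : (fun k => A *m S k) = (fun k => S k *m A).
  by rewrite AS_SA in cvgAS; exact: cvg_unique cvgAS cvgSA.
apply/funext => k; rewrite /S /series/= mulmx_sumr mulmx_suml.
apply: eq_bigr => l _; rewrite -scalemxAr -scalemxAl; congr (_ *: _).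
by rewrite -[LHS]exprS -[RHS]exprSr.
Qed.

Let expmE p i j t : (A ^+ p *m expm A t) i j = limn (pseries (expm_coeff p i j) t).
Proof.
have cvgpE : A ^+ p *m series (fun k => (t ^+ k / k`!%:R) *: A ^+ k) k @[k --> \oo]
    --> A ^+ p *m expm A t.
  by apply: cvg_mulmx; [exact: cvg_cst|exact: cvg_expm].
rewrite -(cvg_lim _ ((cvg_mxP _ _).1 cvgpE i j))//; congr (limn _).
apply/funext => k.
rewrite /pseries /series/= mulmx_sumr summxE; apply: eq_bigr => l _.
by rewrite -scalemxAr mxE -[_ *m _]exprD addnC /expm_coeff; ring.
Qed.

Lemma is_derive_expm (t : R) : is_derive t (1 : R) (expm A) (A *m expm A t).
Proof.
apply/is_derive_mxP => i j.
rewrite -[A in A *m _]expr1 expmE -diffs_expm_coeff.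
rewrite (_ : (fun t => _) = (fun t => limn (pseries (expm_coeff 0 i j) t))).
  by apply: (@pseries_snd_diffs _ _ (`|t| + 1));
    rewrite ?diffs_expm_coeff ?ltr_normr ?ltrDl ?ltr01//; exact: is_cvg_expm_coeff.
by apply/funext => s; rewrite -expmE expr0 mul1mx.
Qed.

Lemma expm0 : expm A 0 = 1%:M.
Proof.
apply/cvg_lim => //; apply: cvg_near_cst; near=> k.
have /prednK <- : (0 < k)%N by near: k; exists 1%N.
rewrite /series/= big_nat_recl//= big1 => [|l _].
  by rewrite addr0 !expr0 fact0 divr1 scale1r.
by rewrite expr0n mul0r scale0r.
Unshelve. all: by end_near. Qed.

Lemma expmD s t : expm A (s + t) = expm A s *m expm A t.
Proof.
pose F x := expm A (s + t - x) *m expm A x.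
suff F_cst : forall x y, F x = F y.
  by have := F_cst 0 t; rewrite /F subr0 expm0 mulmx1 addrK.
have drvF x : is_derive x (1 : R) F 0.
  have drv_sub : is_derive x (1 : R) (fun y => expm A (s + t - y))
      (- (A *m expm A (s + t - x))).
    apply/is_derive_mxP => i j.
    have drv_arg : is_derive x (1 : R) (fun y => s + t - y) (-1).
      by apply: is_derive_eq; rewrite add0r mul1r.
    have /is_derive_mxP/(_ i j) drv_expm := is_derive_expm (s + t - x).
    have := @is_derive1_comp _ (fun y => expm A y i j) _ x _ _ drv_expm drv_arg.
    by rewrite mulrN1 !mxE.
  have -> : 0 = - (A *m expm A (s + t - x)) *m expm A x +
      expm A (s + t - x) *m (A *m expm A x) :> 'M[R]_n.
    by rewrite expm_comm mulNmx mulmxA addNr.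
  exact: is_derive_mulmx drv_sub (is_derive_expm x).
move=> x y; apply/matrixP => i j; apply: (@is_derive_0_is_cst _ (fun x => F x i j)).
by move=> z; have /is_derive_mxP/(_ i j) := drvF z; rewrite mxE.
Qed.

Lemma expmNK t : expm A t *m expm A (- t) = 1%:M.
Proof. by rewrite -expmD subrr expm0. Qed.

Lemma expmKN t : expm A (- t) *m expm A t = 1%:M.
Proof. by rewrite -expmD addNr expm0. Qed.

Lemma expm_unitmx t : expm A t \in unitmx.
Proof. by case: (mulmx1_unit (expmNK t)). Qed.

Lemma trmx_expm t : expm A^T t = (expm A t)^T.
Proof.
apply/cvg_lim => //; apply/cvg_mxP => i j; rewrite mxE.
have trmxX k : A^T ^+ k = (A ^+ k)^T.
  elim: k => [|k IH]; first by rewrite !expr0 trmx1.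
  by rewrite exprS exprSr [RHS]trmx_mul IH.
rewrite (_ : (fun k => _) =
    (fun k => series (fun k => (t ^+ k / k`!%:R) *: A ^+ k) k j i)).
  exact: (cvg_mxP _ _).1 (@cvg_expm t) j i.
apply/funext => k; rewrite /series/= !summxE; apply: eq_bigr => l _.
by rewrite trmxX !mxE.
Qed.

Lemma mulmx_tr_expm_eq0 t z : ((expm A t)^T *m z == 0) = (z == 0 :> 'cV[R]_n).
Proof.
have tr_expm_unit : (expm A t)^T \in unitmx by rewrite unitmx_tr expm_unitmx.
apply/eqP/eqP => [/(congr1 (mulmx (invmx (expm A t)^T)))|->]; last by rewrite mulmx0.
by rewrite mulKmx// mulmx0.
Qed.

End MatrixExponential.

Section NormedModule.
Variables (R : realFieldType) (V : normedModType R).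

Lemma near_mul_dist_le (x : V) c e :
  0 <= c -> 0 < e -> \forall y \near x, c * `|x - y| <= e.
Proof.
move=> c0 e0; have c1 : 0 < c + 1 by rewrite ltr_wpDl.
have e1 : 0 < e / (c + 1) by rewrite divr_gt0.
have := nbhsx_ballx x _ e1; apply: filterS => y; rewrite -ball_normE/= => xy.
apply: (@le_trans _ _ ((c + 1) * (e / (c + 1)))).
  by apply: ler_pM; rewrite ?lerDl// ltW.
by rewrite mulrC divfK// gt_eqF.
Qed.

Lemma lipschitz_le_continuous (f : V -> R) c :
  0 <= c -> (forall x y, f x - f y <= c * `|x - y|) -> continuous f.
Proof.
move=> c0 f_lip x; apply/cvgrPdist_le => e e0.
apply: filterS (near_mul_dist_le x c0 e0) => y cxy.
rewrite ler_norml (le_trans (f_lip x y))// andbT lerNl opprB.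
by rewrite (le_trans (f_lip y x))// distrC.
Qed.

Lemma closure_normP (C : set V) x :
  closure C x <-> forall e, 0 < e -> exists2 p, C p & `|x - p| < e.
Proof.
split=> [Cx e e0|Cx U /nbhs_ballP[e /= e0 xU]].
  by have [p [Cp]] := Cx _ (nbhsx_ballx x e e0); rewrite -ball_normE; exists p.
by have [p Cp xp] := Cx e e0; exists p; split=> //; apply: xU; rewrite -ball_normE.
Qed.

Lemma notin_closure_dist_ge (C : set V) x :
  ~ closure C x -> exists2 d, 0 < d & forall p, C p -> d <= `|x - p|.
Proof.
move=> x_notin; apply: contrapT => no_gap; apply/x_notin/closure_normP => d d0.
apply: contrapT => far; apply: no_gap; exists d => // p Cp.
by rewrite leNgt; apply/negP => xp; apply: far; exists p.
Qed.

End NormedModule.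

Section DotProduct.
Variable R : realType.

Lemma dotvE n (x y : 'cV[R]_n) : dotv x y = (x^T *m y) 0 0.
Proof. by rewrite mxE; apply: eq_bigr => j _; rewrite mxE. Qed.

Lemma dotv_is_linear n (x : 'cV[R]_n) : linear_for *%R (dotv x).
Proof.
by move=> a y z; rewrite !dotvE mulmxDr -scalemxAr [LHS]mxE [X in X + _]mxE.
Qed.

HB.instance Definition _ n (x : 'cV[R]_n) :=
  GRing.isLinear.Build R 'cV[R]_n R *%R (dotv x) (dotv_is_linear x).

Lemma dotvC n (x y : 'cV[R]_n) : dotv x y = dotv y x.
Proof. by apply: eq_bigr => j _; rewrite mulrC. Qed.

Lemma dotvBr n (x y z : 'cV[R]_n) : dotv x (y - z) = dotv x y - dotv x z.
Proof. exact: linearB. Qed.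

Lemma dotvZr n a (x y : 'cV[R]_n) : dotv x (a *: y) = a * dotv x y.
Proof. exact: linearZ. Qed.

Lemma dotvBl n (x y z : 'cV[R]_n) : dotv (x - y) z = dotv x z - dotv y z.
Proof. by rewrite dotvC dotvBr !(dotvC z). Qed.

Lemma dotvZl n a (x y : 'cV[R]_n) : dotv (a *: x) y = a * dotv x y.
Proof. by rewrite dotvC dotvZr dotvC. Qed.

Lemma dotv_mulmx n m (C : 'M[R]_(n, m)) (x : 'cV[R]_n) (y : 'cV[R]_m) :
  dotv x (C *m y) = dotv (C^T *m x) y.
Proof. by rewrite !dotvE trmx_mul trmxK mulmxA. Qed.

Lemma coord_dotv n (x : 'cV[R]_n) i : x i 0 = dotv (delta_mx i 0) x.
Proof.
rewrite /dotv (bigD1 i)//= mxE !eqxx mul1r big1 ?addr0// => j ji.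
by rewrite mxE (negbTE ji) mul0r.
Qed.

Lemma dotv_inj n (x y : 'cV[R]_n) : (forall z, dotv z x = dotv z y) -> x = y.
Proof. by move=> dotxy; apply/colP => i; rewrite !coord_dotv. Qed.

Lemma dotv_ge0 n (x : 'cV[R]_n) : 0 <= dotv x x.
Proof. by apply: sumr_ge0 => j _; rewrite -expr2 sqr_ge0. Qed.

Lemma norm_sqr_le_dotv n (x : 'cV[R]_n) : `|x| ^+ 2 <= dotv x x.
Proof.
have [->|x0] := eqVneq x 0; first by rewrite normr0 expr0n dotv_ge0.
have /mx_norm_neq0[[i j] /= normxE] : mx_norm x != 0 by rewrite -normr_eq0 in x0.
rewrite [`|x|]normxE real_normK ?num_real// (ord1 j) /dotv (bigD1 i)//= expr2 lerDl.
by apply: sumr_ge0 => k _; rewrite -expr2 sqr_ge0.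
Qed.

Lemma dotv_gt0 n (x : 'cV[R]_n) : x != 0 -> 0 < dotv x x.
Proof.
by rewrite -normr_gt0 => x0; rewrite (lt_le_trans _ (norm_sqr_le_dotv x))// exprn_gt0.
Qed.

Lemma dotv_norm_le n (x y : 'cV[R]_n) : `|dotv x y| <= n%:R * `|x| * `|y|.
Proof.
rewrite dotvE (le_trans (norm_coord_le _ _ _))// -(norm_trmx x).
exact: mulmx_norm_le.
Qed.

Lemma is_derive_dotv n (V : normedModType R) (z : 'cV[R]_n) (f : V -> 'cV[R]_n)
    x v df :
  is_derive x v f df -> is_derive x v (fun y => dotv z (f y)) (dotv z df).
Proof.
move=> drvf; rewrite dotvE.
rewrite (_ : (fun y => _) = (fun y => (z^T *m f y) 0 0)); last first.
  by apply/funext => y; rewrite dotvE.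
have := is_derive_mulmx (is_derive_cst z^T x v) drvf.
by rewrite mul0mx add0r => /is_derive_mxP/(_ 0 0).
Qed.

Lemma continuous_dotv n (z : 'cV[R]_n) : continuous (dotv z).
Proof.
apply: (@lipschitz_le_continuous _ _ _ (n%:R * `|z|)) => [|x y].
  by rewrite mulr_ge0.
by rewrite -dotvBr (le_trans (ler_norm _))// dotv_norm_le.
Qed.

Lemma closure_dotv_le n (C : set 'cV[R]_n) (z : 'cV[R]_n) c :
  (forall p, C p -> dotv z p <= c) -> forall x, closure C x -> dotv z x <= c.
Proof.
move=> Cc x Cx.
have closed_half : closed (dotv z @^-1` [set t | t <= c]).
  by apply: preimage_closed => [? _|]; [exact: continuous_dotv|exact: closed_le].
by apply: closed_half; exact: closure_subset Cx.
Qed.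

Lemma compact_unit_sphere n : compact [set x : 'cV[R]_n | `|x| = 1].
Proof.
have -> : [set x : 'cV[R]_n | `|x| = 1] = trmx @` [set y : 'rV[R]_n | `|y| = 1].
  apply/seteqP; split=> [x x1|_ [y y1 <-]] /=; last by rewrite norm_trmx.
  by exists x^T; rewrite ?trmxK//= norm_trmx.
apply: continuous_compact.
  apply: continuous_subspaceT => y; apply/(@cvg_mxP _ _ (nbhs y)) => i j.
  by rewrite mxE; under eq_fun do rewrite mxE; exact: coord_continuous.
apply: bounded_closed_compact.
  by exists 1; split=> // c c1 y /= ->; exact: ltW.
rewrite (_ : mkset _ = (fun y => `|y|) @^-1` [set 1])//.
apply: preimage_closed; last exact: closed_eq.
by move=> y _; exact: norm_continuous.
Qed.

Lemma unit_sphere_le0 n (f : 'cV[R]_n -> R) : continuous f ->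
  (forall e, 0 < e -> exists2 x, `|x| = 1 & f x <= e) ->
  exists2 x, `|x| = 1 & f x <= 0.
Proof.
move=> cf f_small.
have [||x] := compact_EVT_min _ (@compact_unit_sphere n) (f := f).
- by have [x x1 _] := f_small 1 ltr01; exists x.
- exact: continuous_subspaceT.
rewrite inE /= => x1 x_min; exists x => //.
apply/ler_addgt0Pr => e /f_small[y y1 fy]; rewrite add0r (le_trans _ fy)// x_min//.
by rewrite inE.
Qed.

End DotProduct.

Section ConvexSeparation.
Variables (R : realType) (n : nat) (C : set 'cV[R]_n) (y : 'cV[R]_n).
Local Notation sqdist p := (dotv (y - p) (y - p)).

Lemma almost_nearest e : C !=set0 -> 0 < e ->
  exists2 p, C p & forall q, C q -> sqdist p <= sqdist q + e.
Proof.
move=> [c Cc] e0; pose Q := [set sqdist p | p in C].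
have infQ : has_inf Q.
  by split; [exists (sqdist c), c|exists 0 => _ [p _ <-]; exact: dotv_ge0].
have [_ [p Cp <-] p_min] := inf_adherent e0 infQ.
exists p => // q Cq; rewrite (le_trans (ltW p_min))// lerD2r.
by apply: ge_inf; [exact: infQ.2|exists q].
Qed.

Lemma almost_nearest_variational p s : convex_set C -> 0 < s <= 1 ->
  C p -> (forall q, C q -> sqdist p <= sqdist q + s ^+ 2) ->
  forall q, C q -> dotv (y - p) (q - p) <= s / 2 * (1 + dotv (q - p) (q - p)).
Proof.
move=> convC /andP[s0 s1] Cp p_near q Cq.
have /p_near : C (s *: q + (1 - s) *: p).
  by apply/set_mem/(convC q p (Itv01 (ltW s0) s1)); exact/mem_set.
have -> : y - (s *: q + (1 - s) *: p) = (y - p) - s *: (q - p).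
  by apply/colP => i; rewrite !mxE; ring.
move: (y - p) (q - p) => a b; rewrite dotvBl !dotvBr !dotvZl !dotvZr (dotvC b a).
by move=> near_ineq; rewrite -(ler_pM2l s0); lra.
Qed.

(* The distance from [y] to [C] need not be attained, but an almost nearest
   point of [C] already yields a separating direction. *)
Lemma convex_separation : convex_set C -> bounded_set C -> C !=set0 ->
  ~ closure C y ->
  exists2 v : 'cV[R]_n, v != 0 & forall p, C p -> dotv v p <= dotv v y.
Proof.
move=> convC bndC C0 y_notin.
have [d d0 Cd] := notin_closure_dist_ge y_notin.
have sqdist_ge p : C p -> d ^+ 2 <= sqdist p.
  move=> /Cd dp; apply: le_trans (norm_sqr_le_dotv _).
  by rewrite lerXn2r// nnegrE ?normr_ge0 ?ltW.
have [E E0 CE] : exists2 E, 0 <= E &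
    forall p q, C p -> C q -> dotv (q - p) (q - p) <= E.
  have [D0 [_ /(_ (D0 + 1))]] := bndC; rewrite ltrDl ltr01 => /(_ isT) CD.
  exists (n%:R * (D0 + 1 + (D0 + 1)) ^+ 2); first by rewrite mulr_ge0// sqr_ge0.
  move=> p q Cp Cq; rewrite (le_trans (ler_norm _))// (le_trans (dotv_norm_le _ _))//.
  have qp : `|q - p| <= D0 + 1 + (D0 + 1).
    by rewrite (le_trans (ler_normB _ _))// lerD// CD.
  by rewrite -mulrA ler_wpM2l// expr2 ler_pM.
have d20 : 0 < d ^+ 2 by rewrite exprn_gt0.
pose s := Num.min 1 (d ^+ 2 / (1 + E)).
have s0 : 0 < s by rewrite lt_min ltr01 divr_gt0// ltr_wpDr.
have s1 : s <= 1 by rewrite ge_min lexx.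
have sE : s * (1 + E) <= d ^+ 2.
  by rewrite -ler_pdivlMr ?ltr_wpDr// ge_min lexx orbT.
have [p Cp p_near] := almost_nearest C0 (exprn_gt0 2 s0).
exists (y - p).
  by apply/eqP => yp; have := sqdist_ge p Cp; rewrite yp linear0 leNgt d20.
move=> q Cq.
have variational : dotv (y - p) (q - p) <= s / 2 * (1 + dotv (q - p) (q - p)).
  by apply: almost_nearest_variational => //; rewrite s0.
have ypq : dotv (y - p) q - dotv (y - p) y = dotv (y - p) (q - p) - sqdist p.
  by rewrite !dotvBr; ring.
have s_diam : s / 2 * (1 + dotv (q - p) (q - p)) <= s / 2 * (1 + E).
  by rewrite ler_pM2l ?divr_gt0// lerD2l CE.
by have := sqdist_ge p Cp; lra.
Qed.

End ConvexSeparation.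

Lemma countable_simple_zeros (R : realType) (f df : R -> R) :
  (forall t : R, is_derive t (1 : R) f (df t)) ->
  countable [set t | f t = 0 /\ df t != 0].
Proof.
move=> drvf; set Z := mkset _.
apply: (@sub_countable _ _ _ (isolated Z)); last exact: countable_isolated.
apply: subset_card_le => t Zt; split; first exact/mem_set.
have [ft0 dft0] := Zt; have [drvft Dft] := drvf t; rewrite -Dft in dft0.
have [e /= e0 quot_neq0] := cvgr_neq0 _ drvft dft0.
exists (ball t e); first exact: nbhsx_ballx.
apply/seteqP; split=> [s [tse [fs0 _]]|_ ->]; last by split=> //; exact: ballxx.
apply/eqP/negPn/negP => st.
have := quot_neq0 (s - t); rewrite /ball_/= sub0r opprB.
move=> /(_ tse); rewrite subr_eq0 => /(_ st).
by rewrite [(s - t)%:A]mulr1 subrK fs0 ft0 subrr scaler0 eqxx.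
Qed.

Section Controllability.
Variables (R : realType) (n : nat) (A : 'M[R]_n) (b : 'cV[R]_n).

Lemma kalman_dotv_eq0 (w : 'cV[R]_n) : \rank (kalman A b) = n ->
  (forall k, (k < n)%N -> dotv w (A ^+ k *m b) = 0) -> w = 0.
Proof.
move=> rankAb w_orth.
have /row_free_inj inj : row_free (kalman A b) by rewrite /row_free rankAb.
apply: trmx_inj; apply: inj; rewrite trmx0 mul0mx.
apply/rowP => j; rewrite !mxE -[RHS](w_orth j (ltn_ord j)).
by apply: eq_bigr => i _; rewrite !mxE.
Qed.

Lemma is_derive_dotv_expm (z c : 'cV[R]_n) (t : R) :
  is_derive t (1 : R) (fun t => dotv z (expm A t *m c))
    (dotv z (expm A t *m (A *m c))).
Proof.
apply: is_derive_dotv; rewrite mulmxA -expm_comm.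
have := is_derive_mulmx (is_derive_expm A t) (is_derive_cst c t 1).
by rewrite mulmx0 addr0.
Qed.

Lemma continuous_dotv_expm (z c : 'cV[R]_n) :
  continuous (fun t => dotv z (expm A t *m c)).
Proof.
move=> t; apply/differentiable_continuous/derivable1_diffP.
by have [] := is_derive_dotv_expm z c t.
Qed.

(* Every zero is a simple zero of some higher derivative, since by the Kalman
   condition the derivatives of order less than [n] do not all vanish there. *)
Lemma countable_zeros_dotv_expm (z : 'cV[R]_n) :
  \rank (kalman A b) = n -> z != 0 ->
  countable [set t | dotv z (expm A t *m b) = 0].
Proof.
move=> rankAb z0; pose drv k t := dotv z (expm A t *m (A ^+ k *m b)).
apply: (@sub_countable _ _ _
  (\bigcup_(k in [set: nat]) [set t | drv k t = 0 /\ drv k.+1 t != 0])); last first.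
  apply: bigcup_countable => // k _.
  apply: countable_simple_zeros => t; rewrite /drv exprS -mulmxA.
  exact: is_derive_dotv_expm.
apply: subset_card_le => t /= drv0; apply: contrapT => not_simple.
have drvk k : drv k t = 0.
  elim: k => [|k IH]; first by rewrite /drv expr0 mul1mx.
  by apply/eqP/negPn/negP => drvSk; apply: not_simple; exists k.
move/eqP: z0; apply; apply/eqP; rewrite -(mulmx_tr_expm_eq0 A t); apply/eqP.
apply: kalman_dotv_eq0 => // k _; rewrite -dotv_mulmx; exact: drvk.
Qed.

End Controllability.

Section BoundedMeasurable.
Context d (T : measurableType d) (R : realType) (D : set T).
Hypothesis mD : measurable D.
Implicit Types f g : T -> R.

Definition bounded_measurable f :=
  measurable_fun D f /\ exists c : R, forall t, D t -> `|f t| <= c.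

Lemma eq_bounded_measurable f g : {in D, f =1 g} ->
  bounded_measurable f -> bounded_measurable g.
Proof.
move=> fg [mf [c fc]]; split; first exact: eq_measurable_fun mf.
by exists c => t Dt; rewrite -fg ?inE// fc.
Qed.

Lemma bounded_measurable_cst c : bounded_measurable (fun=> c).
Proof. by split; [exact: measurable_cst|exists `|c|]. Qed.

Lemma bounded_measurableD f g : bounded_measurable f -> bounded_measurable g ->
  bounded_measurable (fun t => f t + g t).
Proof.
move=> [mf [c fc]] [mg [c' gc']]; split; first exact: measurable_funD.
exists (c + c') => t Dt.
by rewrite (le_trans (ler_normD _ _))// lerD// ?fc ?gc'.
Qed.

Lemma bounded_measurableM f g : bounded_measurable f -> bounded_measurable g ->
  bounded_measurable (fun t => f t * g t).
Proof.
move=> [mf [c fc]] [mg [c' gc']]; split; first exact: measurable_funM.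
by exists (c * c') => t Dt; rewrite normrM ler_pM// ?fc ?gc'.
Qed.

Lemma bounded_measurableN f : bounded_measurable f ->
  bounded_measurable (fun t => - f t).
Proof.
by move=> [mf [c fc]]; split; [exact: measurableT_comp|exists c => t Dt;
  rewrite normrN fc].
Qed.

Lemma bounded_measurableB f g : bounded_measurable f -> bounded_measurable g ->
  bounded_measurable (fun t => f t - g t).
Proof.
by move=> bf bg; apply: bounded_measurableD => //; exact: bounded_measurableN.
Qed.

Lemma bounded_measurable_norm f : bounded_measurable f ->
  bounded_measurable (fun t => `|f t|).
Proof.
move=> [mf [c fc]]; split; first exact: measurableT_comp.
by exists c => t Dt; rewrite normr_id fc.
Qed.

Lemma bounded_measurable_max f g : bounded_measurable f -> bounded_measurable g ->
  bounded_measurable (fun t => Num.max (f t) (g t)).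
Proof.
move=> [mf [c fc]] [mg [c' gc']]; split; first exact: measurable_maxr.
exists (Num.max c c') => t Dt.
by case: (leP (f t) (g t)) => _; rewrite le_max ?fc ?gc' ?orbT.
Qed.

Lemma bounded_measurable_sum (I : Type) (r : seq I) (F : I -> T -> R) :
  (forall i, bounded_measurable (F i)) ->
  bounded_measurable (fun t => \sum_(i <- r) F i t).
Proof.
move=> bF; elim: r => [|i r IH].
  by under eq_fun do rewrite big_nil; exact: bounded_measurable_cst.
by under eq_fun do rewrite big_cons; exact: bounded_measurableD.
Qed.

Lemma bounded_measurable_sg f : measurable_fun D f ->
  bounded_measurable (fun t => Num.sg (f t)).
Proof.
move=> mf; split; last by exists 1 => t _; rewrite normr_sg lern1 leq_b1.
apply: measurableT_comp mf; apply: nondecreasing_measurable => // x y xy.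
case: (sgrP y) => y0; last by rewrite ltr0_sg// (le_lt_trans xy).
  by rewrite y0 in xy; rewrite sgr_le0.
by case: (sgrP x) => //; lra.
Qed.

End BoundedMeasurable.

Create HintDb bounded_measurable.
(* [apply:] identifies [R] with [measurableTypeR R], which [simple apply] does
   not. *)
#[local] Hint Extern 1 (bounded_measurable _ _) =>
  first [exact: bounded_measurable_cst
        |apply: bounded_measurableD | apply: bounded_measurableB
        |apply: bounded_measurableN | apply: bounded_measurableM
        |apply: bounded_measurable_norm | apply: bounded_measurable_max
        |apply: bounded_measurable_sum] : bounded_measurable.

Section RintegralBoundedMeasurable.
Context d (T : measurableType d) (R : realType).
Variables (mu : {measure set T -> \bar R}) (D : set T).
Hypotheses (mD : measurable D) (muD : (mu D < +oo)%E).
Implicit Types f g w : T -> R.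

Lemma bounded_measurable_integrable f :
  bounded_measurable D f -> mu.-integrable D (EFin \o f).
Proof.
move=> [mf [c fc]]; apply: measurable_bounded_integrable => //.
by exists c; split=> [|c' cc' t /fc /le_trans]; [exact: num_real|apply; exact: ltW].
Qed.
#[local] Hint Resolve bounded_measurable_integrable : bounded_measurable.

Lemma Rintegral_sum (I : Type) (r : seq I) (F : I -> T -> R) :
  (forall i, mu.-integrable D (EFin \o F i)) ->
  \int[mu]_(t in D) (\sum_(i <- r) F i t) = \sum_(i <- r) \int[mu]_(t in D) F i t.
Proof.
move=> intF; rewrite /Rintegral; under eq_integral do rewrite -sumEFin.
rewrite integral_sum// sum_fine// => i _.
exact: integrable_fin_num (intF i).
Qed.

Lemma ae_eq_Rintegral f g : measurable_fun D f -> measurable_fun D g ->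
  {ae mu, forall t, D t -> f t = g t} ->
  \int[mu]_(t in D) f t = \int[mu]_(t in D) g t.
Proof.
move=> mf mg fg; congr fine; apply: ae_eq_integral => //;
  do ?exact/measurable_EFinP.
by apply: filterS fg => t fg Dt; rewrite fg.
Qed.

Let bounded_measurable_tent k f : bounded_measurable D f ->
  bounded_measurable D (fun t => Num.max 0 (1 - k * `|f t|)).
Proof. by auto 6 with bounded_measurable. Qed.

Lemma cvg_Rintegral_tent f : bounded_measurable D f ->
  {ae mu, forall t, D t -> f t != 0} ->
  \int[mu]_(t in D) Num.max 0 (1 - n%:R * `|f t|) @[n --> \oo] --> (0 : R).
Proof.
move=> bf f_neq0; pose tent (n : nat) t : R := Num.max 0 (1 - n%:R * `|f t|).
have mtent n : measurable_fun D (EFin \o tent n).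
  by apply/measurable_EFinP; have [] := bounded_measurable_tent n%:R bf.
have [|||_ _ cvg_int] := @dominated_convergence _ _ _ mu D mD
    (fun n => EFin \o tent n) (cst 0%E) (cst 1%E) mtent (measurable_cst _).
- apply: filterS f_neq0 => t f_neq0 Dt.
  apply: cvg_near_cst; near=> n => /=; congr EFin.
  have f0 : 0 < `|f t| by rewrite normr_gt0 f_neq0.
  apply/max_idPl; rewrite subr_le0 -ler_pdivrMr// div1r.
  by near: n; exact: nbhs_infty_ger.
- exact: bounded_measurable_integrable (bounded_measurable_cst D 1).
- apply: aeW => t n _; rewrite /= lee_fin ger0_norm; last by rewrite le_max lexx.
  by rewrite ge_max ler01 lerBlDr lerDl mulr_ge0.
- by rewrite integral0 in cvg_int; exact: (fine_cvg cvg_int).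
Unshelve. all: by end_near. Qed.

(* Split [D] according to whether [1 <= k * `|f t|], for [k] so large that the
   complement contributes little. *)
Lemma Rintegral_norm_small_of_weighted f c e : bounded_measurable D f ->
  {ae mu, forall t, D t -> f t != 0} -> 0 <= c -> 0 < e ->
  exists2 eta, 0 < eta & forall w, bounded_measurable D w ->
    (forall t, D t -> `|w t| <= c) ->
    \int[mu]_(t in D) (`|f t| * `|w t|) <= eta ->
    \int[mu]_(t in D) `|w t| <= e.
Proof.
move=> bf f_neq0 c0 e0.
have ec : 0 < e / 2 / (c + 1) by rewrite !divr_gt0// ltr_wpDl.
have /cvgrPdist_lt/(_ _ ec)[k _ /(_ k (leqnn _))] := cvg_Rintegral_tent bf f_neq0.
rewrite /= sub0r normrN => /(le_lt_trans (ler_norm _)).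
set tent := fun t => Num.max 0 (1 - k%:R * `|f t|) => int_tent.
exists (e / 2 / (k%:R + 1)); first by rewrite !divr_gt0// ltr_wpDl.
move=> w bw wc int_fw.
have btent : bounded_measurable D tent by exact: bounded_measurable_tent.
apply: (@le_trans _ _ (\int[mu]_(t in D) (k%:R * (`|f t| * `|w t|) + c * tent t))).
  apply: le_Rintegral => //.
  - by auto with bounded_measurable.
  - by auto 7 with bounded_measurable.
  - move=> t /wc; have := normr_ge0 (w t); have := normr_ge0 (f t).
    set F := `|f t|; set W := `|w t| => F0 W0 Wc; rewrite /tent -/F.
    by case: (leP 0 (1 - k%:R * F)) => ?; nra.
rewrite RintegralD// ?RintegralZl//; try by auto 7 with bounded_measurable.
have k_small : k%:R * \int[mu]_(t in D) (`|f t| * `|w t|) <= e / 2.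
  apply: (@le_trans _ _ ((k%:R + 1) * (e / 2 / (k%:R + 1)))).
    apply: ler_pM => //; last by rewrite lerDl.
    by apply: Rintegral_ge0 => t _; exact: mulr_ge0.
  by rewrite mulrC divfK// gt_eqF// ltr_wpDl.
have c_small : c * \int[mu]_(t in D) tent t <= e / 2.
  apply: (@le_trans _ _ ((c + 1) * (e / 2 / (c + 1)))).
    apply: ler_pM => //; [|by rewrite lerDl|exact: ltW].
    by apply: Rintegral_ge0 => t _; rewrite le_max lexx.
  by rewrite mulrC divfK// gt_eqF// ltr_wpDl.
lra.
Qed.

Lemma Rintegral_norm_gt0 f : bounded_measurable D f -> (0 < mu D)%E ->
  {ae mu, forall t, D t -> f t != 0} -> 0 < \int[mu]_(t in D) `|f t|.
Proof.
move=> bf muD0 f_neq0.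
have fine_muD : 0 < fine (mu D) by rewrite fine_gt0// muD0.
have muD2 : 0 < fine (mu D) / 2 by rewrite divr_gt0.
have [eta eta0 small] := Rintegral_norm_small_of_weighted bf f_neq0 ler01 muD2.
rewrite ltNge; apply/negP => int_le0.
have := small (cst 1) (bounded_measurable_cst D 1).
rewrite /= normr1 Rintegral_cst// mul1r.
under eq_Rintegral do rewrite mulr1.
move=> /(_ (fun _ _ => lexx _) (le_trans int_le0 (ltW eta0))).
lra.
Qed.

End RintegralBoundedMeasurable.

Section LebesgueIntervals.
Variable R : realType.
Local Notation mu := (@lebesgue_measure R).
Implicit Types (a b c r : R) (f g : R -> R) (D : set R).

Lemma lebesgue_measure_itvcc_lty a b : (mu `[a, b] < +oo)%E.
Proof. by rewrite lebesgue_measure_itv/=; case: ifP => // _; exact: ltry. Qed.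

Lemma lebesgue_measure_itvcc_gt0 a b : a < b -> (0 < mu `[a, b])%E.
Proof. by move=> ab; rewrite lebesgue_measure_itv/= lte_fin ab lte_fin subr_gt0. Qed.

Lemma fine_lebesgue_measure_itvcc a b : a <= b -> fine (mu `[a, b]) = b - a.
Proof.
rewrite lebesgue_measure_itv/= lte_fin le_eqVlt => /predU1P[->|->//].
by rewrite ltxx subrr.
Qed.

Lemma ae_notin_countable D : countable D -> {ae mu, forall t, ~ D t}.
Proof.
move=> cD; exists D; split => [||t /= /contrapT//].
- by apply: countable_measurable => //; exact: measurable_set1.
- exact: countable_lebesgue_measure0.
Qed.

Lemma continuous_bounded_measurable a b f :
  continuous f -> bounded_measurable `[a, b] f.
Proof.
move=> cf; split; first by apply: measurable_funTS; exact: continuous_measurable_fun.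
have /compact_bounded[c [_ /(_ (c + 1))]] : compact (f @` `[a, b]).
  apply: continuous_compact; last exact: segment_compact.
  exact: continuous_subspaceT.
by rewrite ltrDl ltr01 => /(_ isT) fc; exists (c + 1) => t tab; apply: fc; exists t.
Qed.

Lemma Rintegral_itv_cat a b c f : a <= b -> b <= c ->
  mu.-integrable `[a, c] (EFin \o f) ->
  \int[mu]_(t in `[a, c]) f t =
  \int[mu]_(t in `[a, b]) f t + \int[mu]_(t in `[b, c]) f t.
Proof.
move=> ab bc intf; have := @Rintegral_itvB _ f (BLeft a) (BRight c) b intf.
rewrite !bnd_simp => /(_ ab bc); rewrite Rintegral_itv_obnd_cbnd.
  by move=> <-; rewrite addrC subrK.
by apply: integrableS intf => //; apply: subset_itvr; rewrite bnd_simp.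
Qed.

Lemma bounded_measurable_reflection r f : bounded_measurable `[0, r] f ->
  bounded_measurable `[0, r] (fun t => f (r - t)).
Proof.
have reflect_itv t : (r - t \in `[0, r]) = (t \in `[0, r]) by rewrite !in_itv/=; lra.
move=> [mf [c fc]]; split; last first.
  by exists c => t tr; apply: fc; rewrite /= reflect_itv.
apply: (@measurable_comp _ _ _ _ _ _ `[0, r]) mf _ => //.
  by move=> _ [t /= tr <-]; rewrite reflect_itv.
exact: measurable_funB.
Qed.

(* Typed as a map into [measurableTypeR R] so that the pushforward of [mu]
   along it is a measure on the same space. *)
Let reflection c : R -> measurableTypeR R := fun t => c - t.

Let measurable_reflection c : measurable_fun [set: R] (reflection c).
Proof. exact: measurable_funB. Qed.

Lemma lebesgue_measure_reflection c D : measurable D ->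
  pushforward mu (reflection c) D = mu D.
Proof.
move=> mD; apply/esym/lebesgue_measure_unique => //=.
  exact: measurable_reflection.
move=> _ _ [[a b]] _ <-.
rewrite /pushforward (_ : _ @^-1` _ = `[c - b, c - a[%classic).
  rewrite !lebesgue_measure_itv/= !lte_fin ltrD2l ltrN2.
  by case: ifP => // _; rewrite -!EFinB; congr EFin; lra.
by apply/seteqP; split=> t /=; rewrite !in_itv/= /reflection; lra.
Qed.

Let ge0_integral_reflection c D (f : R -> \bar R) : measurable D ->
  measurable_fun D f -> (forall t, 0 <= f t)%E ->
  (\int[mu]_(t in D) f t =
   \int[mu]_(t in reflection c @^-1` D) (f \o reflection c) t)%E.
Proof.
move=> mD mf f0; rewrite -[RHS]ge0_integral_pushforward//=.
  apply: eq_measure_integral => //= [|_ S mS _]; first exact: measurable_reflection.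
  by rewrite lebesgue_measure_reflection.
exact: measurable_reflection.
Qed.

Lemma integral_reflection c D (f : R -> \bar R) : measurable D ->
  measurable_fun D f ->
  (\int[mu]_(t in D) f t = \int[mu]_(t in [set t | D (c - t)%R]) f (c - t)%R)%E.
Proof.
move=> mD mf; rewrite integralE (integralE mu [set t | D (c - t)]).
rewrite (ge0_integral_reflection c mD (measurable_funepos mf)); last first.
  by move=> t; exact: funepos_ge0.
rewrite (ge0_integral_reflection c mD (measurable_funeneg mf)); last first.
  by move=> t; exact: funeneg_ge0.
congr (_ - _)%E; apply: eq_integral => t _ /=.
  by rewrite !funeposE.
by rewrite !funenegE.
Qed.

Lemma Rintegral_reflection r f : measurable_fun `[0, r] f ->
  \int[mu]_(t in `[0, r]) f t = \int[mu]_(t in `[0, r]) f (r - t).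
Proof.
move=> /measurable_EFinP mf; congr fine; rewrite (integral_reflection r _ mf)//.
by congr (integral _ _ _); apply/seteqP; split=> t /=; rewrite !in_itv/=; lra.
Qed.

End LebesgueIntervals.

Lemma bounded_measurable_integrable_itv (R : realType) (a b : R) (f : R -> R) :
  bounded_measurable `[a, b] f ->
  lebesgue_measure.-integrable `[a, b] (EFin \o f).
Proof.
by move=> bf; apply: bounded_measurable_integrable => //;
  exact: lebesgue_measure_itvcc_lty.
Qed.
#[local] Hint Extern 2 =>
  apply: bounded_measurable_integrable_itv : bounded_measurable.

Section BoundedMeasurableVector.
Variables (R : realType) (n : nat) (D : set R).
Implicit Types F G : R -> 'cV[R]_n.

Definition bounded_measurable_cV F :=
  forall j, bounded_measurable D (fun t => F t j 0).

Lemma bounded_measurable_coord F j :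
  bounded_measurable_cV F -> bounded_measurable D (fun t => F t j 0).
Proof. exact. Qed.

Lemma bounded_measurable_dotv z F : measurable D -> bounded_measurable_cV F ->
  bounded_measurable D (fun t => dotv z (F t)).
Proof.
move=> mD bF; apply: bounded_measurable_sum => // j.
by auto with bounded_measurable.
Qed.

Lemma bounded_measurable_cV_dotvP F :
  (forall z, bounded_measurable D (fun t => dotv z (F t))) ->
  bounded_measurable_cV F.
Proof.
move=> bF j; apply: eq_bounded_measurable (bF (delta_mx j 0)) => t _.
by rewrite -coord_dotv.
Qed.

Lemma bounded_measurable_cV_norm_le F : bounded_measurable_cV F ->
  exists2 c, 0 <= c & forall t, D t -> `|F t| <= c.
Proof.
move=> bF; have /choice[c Fc] : forall j, exists c : R, forall t, D t ->
    `|F t j 0| <= c by move=> j; have [] := bF j.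
exists (\sum_j `|c j|); first exact: sumr_ge0.
move=> t Dt; apply/mx_norm_leP => [|j k]; first exact: sumr_ge0.
rewrite ord1 (bigD1 j)//= (le_trans (Fc _ _ Dt))// (le_trans (ler_norm _))//.
by rewrite lerDl sumr_ge0.
Qed.

Lemma bounded_measurable_cVB F G : measurable D ->
  bounded_measurable_cV F -> bounded_measurable_cV G ->
  bounded_measurable_cV (fun t => F t - G t).
Proof.
move=> mD bF bG j.
apply: (@eq_bounded_measurable _ _ _ _ (fun t => F t j 0 - G t j 0)).
  by move=> t _; rewrite !mxE.
by auto with bounded_measurable.
Qed.

End BoundedMeasurableVector.

#[local] Hint Extern 0 (bounded_measurable _ _) =>
  exact: bounded_measurable_coord : bounded_measurable.
#[local] Hint Extern 0 (bounded_measurable _ _) =>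
  exact: bounded_measurable_dotv : bounded_measurable.

Section VectorIntegral.
Variable R : realType.
Local Notation mu := (@lebesgue_measure R).
Implicit Types (a b c : R).

Lemma eq_vint n a b (F G : R -> 'cV[R]_n) :
  {in `[a, b], F =1 G} -> vint a b F = vint a b G.
Proof.
move=> FG; apply/colP => j; rewrite !mxE; apply: eq_Rintegral => t.
by rewrite inE => /FG ->.
Qed.

Lemma ae_eq_vint n a b (F G : R -> 'cV[R]_n) :
  bounded_measurable_cV `[a, b] F -> bounded_measurable_cV `[a, b] G ->
  {ae mu, forall t, t \in `[a, b] -> F t = G t} -> vint a b F = vint a b G.
Proof.
move=> bF bG FG; apply/colP => j; rewrite !mxE.
apply: ae_eq_Rintegral => //; [by have [] := bF j|by have [] := bG j|].
by apply: (@filterS _ _ (ae_filter_ringOfSetsType mu)) FG => t FG tab; rewrite FG.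
Qed.

Lemma vint_lin n a b k l (F G : R -> 'cV[R]_n) :
  bounded_measurable_cV `[a, b] F -> bounded_measurable_cV `[a, b] G ->
  vint a b (fun t => k *: F t + l *: G t) = k *: vint a b F + l *: vint a b G.
Proof.
move=> bF bG; apply/colP => j; rewrite !mxE.
under eq_Rintegral do rewrite !mxE.
by rewrite RintegralD// ?RintegralZl//; auto with bounded_measurable.
Qed.

Lemma vint_cat n a b c (F : R -> 'cV[R]_n) : a <= b -> b <= c ->
  bounded_measurable_cV `[a, c] F ->
  vint a c F = vint a b F + vint b c F.
Proof.
move=> ab bc bF; apply/colP => j; rewrite !mxE.
by apply: Rintegral_itv_cat; auto with bounded_measurable.
Qed.

Lemma dotv_vint n a b (z : 'cV[R]_n) F : bounded_measurable_cV `[a, b] F ->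
  dotv z (vint a b F) = \int[mu]_(t in `[a, b]) dotv z (F t).
Proof.
move=> bF; rewrite Rintegral_sum//; last by auto with bounded_measurable.
by apply: eq_bigr => j _; rewrite mxE RintegralZl//; auto with bounded_measurable.
Qed.

Lemma mulmx_vint n m a b (C : 'M[R]_(m, n)) F : bounded_measurable_cV `[a, b] F ->
  C *m vint a b F = vint a b (fun t => C *m F t).
Proof.
move=> bF; have bCF : bounded_measurable_cV `[a, b] (fun t => C *m F t).
  apply: bounded_measurable_cV_dotvP => z.
  apply: (@eq_bounded_measurable _ _ _ _ (fun t => dotv (C^T *m z) (F t))).
    by move=> t _; rewrite dotv_mulmx.
  by auto with bounded_measurable.
apply: dotv_inj => z; rewrite dotv_mulmx !dotv_vint//.
by apply: eq_Rintegral => t _; rewrite dotv_mulmx.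
Qed.

End VectorIntegral.

Section SwitchingFunctions.
Variables (R : realType) (N M : nat) (A : 'M[R]_N) (B : 'M[R]_(N, M)).
Local Notation mu := (@lebesgue_measure R).
Implicit Types (a b s : R) (z : 'cV[R]_N) (j : 'I_M).

(* [<lambda(s), b_j>] along the adjoint arc [lambda(s) = e^{-A^T s} z] of the
   forward dynamics. *)
Definition switching z j s : R := dotv z (expm A (- s) *m col j B).

Lemma continuous_switching z j : continuous (switching z j).
Proof.
move=> s; apply: (@continuous_comp _ _ _ -%R (fun t => dotv z (expm A t *m col j B))).
  exact: opp_continuous.
exact: continuous_dotv_expm.
Qed.

Lemma bounded_measurable_switching a b z j :
  bounded_measurable `[a, b] (switching z j).
Proof. exact/continuous_bounded_measurable/continuous_switching. Qed.
#[local] Hint Resolve bounded_measurable_switching : bounded_measurable.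

Lemma ae_switching_neq0 z j : \rank (kalman A (col j B)) = N -> z != 0 ->
  {ae mu, forall s, switching z j s != 0}.
Proof.
move=> rankAb z0; have cZ : countable [set s | switching z j s = 0].
  apply: (@sub_countable _ _ _ (-%R @` [set t | dotv z (expm A t *m col j B) = 0])).
    by apply: subset_card_le => s swz; exists (- s) => //; rewrite opprK.
  exact: sub_countable (card_image_le _ _) (countable_zeros_dotv_expm rankAb z0).
apply: (@filterS _ _ (ae_filter_ringOfSetsType mu)) (ae_notin_countable cZ).
by move=> s /eqP.
Qed.

Lemma switchingZ k z j s : switching (k *: z) j s = k * switching z j s.
Proof. exact: dotvZl. Qed.

Lemma switchingB z z' j s :
  switching (z - z') j s = switching z j s - switching z' j s.
Proof. exact: dotvBl. Qed.

Lemma switching_le a b : exists2 c, 0 <= c &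
  forall z j s, a <= s <= b -> `|switching z j s| <= c * `|z|.
Proof.
have /choice[c cP] : forall j, exists c : R, 0 <= c /\
    forall s, a <= s <= b -> `|expm A (- s) *m col j B| <= c.
  move=> j; have /bounded_measurable_cV_norm_le[c c0 cP] :
      bounded_measurable_cV `[a, b] (fun s => expm A (- s) *m col j B).
    by apply: bounded_measurable_cV_dotvP => z; exact: bounded_measurable_switching.
  by exists c; split=> // s sab; apply: cP; rewrite /= in_itv.
have c0 j : 0 <= c j by have [] := cP j.
exists (N%:R * \sum_j c j); first by rewrite mulr_ge0// sumr_ge0.
move=> z j s sab; rewrite (le_trans (dotv_norm_le _ _))// mulrAC ler_wpM2r//.
rewrite ler_wpM2l// (le_trans ((cP j).2 _ sab))// (bigD1 j)//= lerDl.
exact: sumr_ge0.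
Qed.

Lemma dotv_mulmx_cols z (w : 'cV[R]_M) :
  dotv z (B *m w) = \sum_j w j 0 * dotv z (col j B).
Proof.
have -> : B *m w = \sum_j w j 0 *: col j B.
  apply/colP => i; rewrite !mxE summxE; apply: eq_bigr => j _.
  by rewrite !mxE mulrC.
by rewrite linear_sum/=; apply: eq_bigr => j _; rewrite dotvZr.
Qed.

Lemma dotv_expm_cols z (w : 'cV[R]_M) s :
  dotv z (expm A (- s) *m (B *m w)) = \sum_j w j 0 * switching z j s.
Proof.
rewrite dotv_mulmx dotv_mulmx_cols; apply: eq_bigr => j _.
by rewrite -dotv_mulmx.
Qed.

Lemma bounded_measurable_steer_integrand a b u : bounded_measurable_cV `[a, b] u ->
  bounded_measurable_cV `[a, b] (fun s => expm A (- s) *m (B *m u s)).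
Proof.
move=> bu; apply: bounded_measurable_cV_dotvP => z.
apply: (@eq_bounded_measurable _ _ _ _ (fun s => \sum_j u s j 0 * switching z j s)).
  by move=> s _; rewrite dotv_expm_cols.
by apply: bounded_measurable_sum => // j; auto with bounded_measurable.
Qed.

End SwitchingFunctions.

#[local] Hint Resolve bounded_measurable_steer_integrand : bounded_measurable.
#[local] Hint Extern 0 (bounded_measurable _ _) =>
  exact: bounded_measurable_switching : bounded_measurable.

Section Steering.
Variables (R : realType) (N M : nat) (A : 'M[R]_N) (B : 'M[R]_(N, M)).
Local Notation mu := (@lebesgue_measure R).
Local Notation switching := (switching A B).
Implicit Types (a b c : R) (z : 'cV[R]_N) (u v : R -> 'cV[R]_M).

Definition steer a b u : 'cV[R]_N :=
  vint a b (fun s => expm A (- s) *m (B *m u s)).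

Lemma eq_steer a b u v : {in `[a, b], u =1 v} -> steer a b u = steer a b v.
Proof. by move=> uv; apply: eq_vint => s /uv ->. Qed.

Lemma dotv_steer z a b u : bounded_measurable_cV `[a, b] u ->
  dotv z (steer a b u) =
  \sum_j \int[mu]_(s in `[a, b]) (u s j 0 * switching z j s).
Proof.
move=> bu; rewrite dotv_vint; last by auto with bounded_measurable.
rewrite -Rintegral_sum//; last by auto with bounded_measurable.
by apply: eq_Rintegral => s _; rewrite dotv_expm_cols.
Qed.

Lemma steer_lin a b k l u v :
  bounded_measurable_cV `[a, b] u -> bounded_measurable_cV `[a, b] v ->
  steer a b (fun s => k *: u s + l *: v s) = k *: steer a b u + l *: steer a b v.
Proof.
move=> bu bv; rewrite -vint_lin; [|by auto with bounded_measurable..].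
by apply: eq_vint => s _; rewrite !mulmxDr -!scalemxAr.
Qed.

Lemma steerB a b u v :
  bounded_measurable_cV `[a, b] u -> bounded_measurable_cV `[a, b] v ->
  steer a b (fun s => u s - v s) = steer a b u - steer a b v.
Proof.
move=> bu bv; have := steer_lin 1 (-1) bu bv; rewrite scale1r scaleN1r => <-.
by apply: eq_steer => s _; rewrite scale1r scaleN1r.
Qed.

Lemma steer_cat a b c u : a <= b -> b <= c -> bounded_measurable_cV `[a, c] u ->
  steer a c u = steer a b u + steer b c u.
Proof. by move=> ab bc bu; apply: vint_cat; auto with bounded_measurable. Qed.

Lemma steer_norm_le a b : exists2 c, 0 <= c & forall a' b' u,
  a <= a' -> b' <= b -> bounded_measurable_cV `[a', b'] u ->
  `|steer a' b' u| <= c * \sum_j \int[mu]_(s in `[a', b']) `|u s j 0|.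
Proof.
have [c c0 cP] := switching_le A B a b; exists c => // a' b' u aa' b'b bu.
have int_ge0 j : 0 <= \int[mu]_(s in `[a', b']) `|u s j 0| by exact: Rintegral_ge0.
apply/mx_norm_leP => [|i k]; first by rewrite mulr_ge0// sumr_ge0.
rewrite ord1 coord_dotv dotv_steer// (le_trans (ler_norm_sum _ _ _))// mulr_sumr.
apply: ler_sum => j _; apply: le_trans (le_normr_Rintegral _ _) _ => //.
  by auto with bounded_measurable.
rewrite -RintegralZl//; last by auto with bounded_measurable.
apply: le_Rintegral => //; [by auto with bounded_measurable..|].
move=> s /=; rewrite in_itv/= => /andP[a's sb'].
rewrite normrM mulrC ler_wpM2r// (le_trans (cP _ _ _ _))//.
  by rewrite (le_trans aa')// (le_trans sb').
rewrite ler_piMr//; apply/mx_norm_leP => // i' k'.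
by rewrite mxE; case: (_ && _); rewrite ?normr1 ?normr0.
Qed.

End Steering.

Section AdmissibleControls.
Variables (R : realType) (N M : nat) (A : 'M[R]_N) (B : 'M[R]_(N, M)).
Local Notation mu := (@lebesgue_measure R).
Local Notation switching := (switching A B).
Local Notation steer := (steer A B).
Implicit Types (a b c r s t theta : R) (x y z p : 'cV[R]_N) (j : 'I_M).
Implicit Types (u v w : R -> 'cV[R]_M).

Definition admissible_on a b u :=
  (forall j, measurable_fun `[a, b] (fun t => u t j 0)) /\
  (forall t, a <= t <= b -> forall j, -1 <= u t j 0 <= 1).

Lemma admissible_on_bounded_measurable a b u :
  admissible_on a b u -> bounded_measurable_cV `[a, b] u.
Proof.
move=> [meas_u u1] j; split; first exact: meas_u.
by exists 1 => t /=; rewrite in_itv/= ler_norml => /u1.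
Qed.

Lemma admissible_onS a b a' b' u : a <= a' -> b' <= b ->
  admissible_on a b u -> admissible_on a' b' u.
Proof.
move=> aa' b'b [meas_u u1]; split=> [j|t /andP[a't tb'] j].
  by apply: measurable_funS (meas_u j) => //; apply: subset_itvScc; rewrite bnd_simp.
by apply: u1; rewrite (le_trans aa')// (le_trans tb').
Qed.

Lemma admissible_on_cat a b c u v : a <= b -> b <= c ->
  admissible_on a b u -> admissible_on b c v ->
  admissible_on a c (fun t => if t <= b then u t else v t).
Proof.
move=> ab bc [meas_u u1] [meas_v v1]; split=> [j|t /andP[a_t t_c] j]; last first.
  by case: (leP t b) => tb; [apply: u1; rewrite a_t|apply: v1; rewrite (ltW tb)].
apply: (eq_measurable_fun (fun t => if t <= b then u t j 0 else v t j 0)).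
  by move=> t _; case: ifP.
apply: measurable_fun_if => //; first exact: measurable_fun_ler.
  apply: measurable_funS (meas_u j) => // t /= [].
  by rewrite !in_itv/= => /andP[-> _] ->.
apply: measurable_funS (meas_v j) => // t /= []; rewrite !in_itv/= => /andP[_ ->].
by move=> /negbT; rewrite -ltNge => /ltW ->.
Qed.

Lemma admissible_on_conv a b k u v : 0 <= k <= 1 ->
  admissible_on a b u -> admissible_on a b v ->
  admissible_on a b (fun t => k *: u t + (1 - k) *: v t).
Proof.
move=> k01 [meas_u u1] [meas_v v1]; split=> [j|t tab j]; last first.
  by have := u1 t tab j; have := v1 t tab j; rewrite !mxE; nra.
apply: (eq_measurable_fun (fun t => k * u t j 0 + (1 - k) * v t j 0)).
  by move=> t _; rewrite !mxE.
by apply: measurable_funD; apply: measurable_funM.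
Qed.

Lemma admissible_on_cst0 a b : admissible_on a b (fun=> 0 : 'cV[R]_M).
Proof.
split=> [j|t _ j]; last by rewrite mxE; lra.
exact: measurable_cst.
Qed.

Lemma steer_cst0 a b : steer a b (fun=> 0) = 0.
Proof.
apply/colP => i; rewrite !mxE; under eq_Rintegral do rewrite !mulmx0 mxE.
by rewrite Rintegral_cst// mul0r.
Qed.

Lemma steer_admissible_on_norm_le a b : exists2 c, 0 <= c & forall a' b' u,
  a <= a' -> a' <= b' -> b' <= b -> admissible_on a' b' u ->
  `|steer a' b' u| <= c * (b' - a').
Proof.
have [c c0 cP] := steer_norm_le A B a b; exists (c * M%:R); first exact: mulr_ge0.
move=> a' b' u aa' a'b' b'b au; have bu := admissible_on_bounded_measurable au.
apply: le_trans (cP _ _ _ aa' b'b bu) _; rewrite -mulrA ler_wpM2l//.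
have -> : M%:R * (b' - a') = \sum_(j < M) (b' - a').
  by rewrite sumr_const card_ord mulr_natl.
apply: ler_sum => j _.
rewrite -[leRHS]mul1r -(fine_lebesgue_measure_itvcc a'b') -Rintegral_cst//.
apply: le_Rintegral => //; [by auto with bounded_measurable..|].
by move=> s /=; rewrite in_itv/= => sab; rewrite ler_norml; exact: au.2.
Qed.

Lemma admissible_on_integrand_le a b u z j s : admissible_on a b u -> a <= s <= b ->
  `|u s j 0 * switching z j s| <= `|switching z j s|.
Proof. by move=> au sab; rewrite normrM ler_piMl// ler_norml; exact: au.2. Qed.

Lemma fwd_solE theta u x : admissible theta u ->
  fwd_sol A B u x theta = expm A theta *m (x + steer 0 theta u).
Proof.
move=> /admissible_on_bounded_measurable bu.
rewrite /fwd_sol mulmxDr mulmx_vint; last by auto with bounded_measurable.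
by congr (_ + _); apply: eq_vint => s _; rewrite [RHS]mulmxA -expmD.
Qed.

Lemma fwd_sol_eq0 theta u x : admissible theta u ->
  fwd_sol A B u x theta = 0 <-> x = - steer 0 theta u.
Proof.
move=> au; rewrite fwd_solE//; split=> [|->]; last by rewrite addNr mulmx0.
move/(congr1 (mulmx (expm A (- theta)))); rewrite mulmxA expmKN mul1mx mulmx0.
by move/eqP; rewrite addr_eq0 => /eqP.
Qed.

Definition reach theta : set 'cV[R]_N :=
  [set - steer 0 theta u | u in admissible theta].

Lemma reach_cat theta theta' p v : 0 <= theta -> theta <= theta' ->
  reach theta p -> admissible_on theta theta' v ->
  reach theta' (p - steer theta theta' v).
Proof.
move=> th0 thth' [u au <-] av; pose w t := if t <= theta then u t else v t.
have aw : admissible_on 0 theta' w by exact: admissible_on_cat.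
have bw := admissible_on_bounded_measurable aw.
exists w => //; rewrite (steer_cat _ _ th0 thth' bw) opprD; congr (- _ - _).
  by apply: eq_steer => s; rewrite in_itv/= /w => /andP[_ ->].
have bw' : bounded_measurable_cV `[theta, theta'] w.
  by apply: admissible_on_bounded_measurable; exact: admissible_onS aw.
have bv := admissible_on_bounded_measurable av.
apply: ae_eq_vint; [by auto with bounded_measurable..|].
apply: (@filterS _ _ (ae_filter_ringOfSetsType mu))
  (ae_notin_countable (countable1 theta)) => s s_neq.
rewrite in_itv/= /w => /andP[ths _]; case: (leP s theta) => // sth.
by case: s_neq; apply/eqP; rewrite eq_le sth.
Qed.

Lemma reach_split theta theta' x : 0 <= theta -> theta <= theta' ->
  reach theta' x -> exists p v,
    [/\ reach theta p, admissible_on theta theta' v & x = p - steer theta theta' v].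
Proof.
move=> th0 thth' [u au <-]; exists (- steer 0 theta u), u; split.
- by exists u => //; exact: admissible_onS au.
- exact: admissible_onS au.
- rewrite -opprD -steer_cat//; exact: (admissible_on_bounded_measurable au).
Qed.

Lemma reach_mono theta theta' x : 0 <= theta -> theta <= theta' ->
  reach theta x -> reach theta' x.
Proof.
move=> th0 thth' rx; rewrite -[x]subr0 -(steer_cst0 theta theta').
by apply: reach_cat => //; exact: admissible_on_cst0.
Qed.

Lemma reach_convex theta : convex_set (reach theta).
Proof.
move=> _ _ k /set_mem[u au <-] /set_mem[v av <-]; apply/mem_set.
have bu := admissible_on_bounded_measurable au.
have bv := admissible_on_bounded_measurable av.
exists (fun t => k%:num *: u t + (1 - k%:num) *: v t).
  by apply: admissible_on_conv; rewrite ?ge0 ?le1.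
by rewrite steer_lin// opprD -!scalerN.
Qed.

Lemma reach_norm_le b : exists2 c, 0 <= c &
  forall theta x, 0 <= theta <= b -> reach theta x -> `|x| <= c * theta.
Proof.
have [c c0 cP] := steer_admissible_on_norm_le 0 b.
exists c => // theta x /andP[th0 thb] [u au <-].
by rewrite normrN -[theta in leRHS]subr0; exact: cP.
Qed.

End AdmissibleControls.

Section SupportFunction.
Variables (R : realType) (N M : nat) (A : 'M[R]_N) (B : 'M[R]_(N, M)).
Local Notation mu := (@lebesgue_measure R).
Local Notation switching := (switching A B).
Local Notation steer := (steer A B).
Local Notation reach := (reach A B).
Implicit Types (a b c r s t theta e : R) (x y z p : 'cV[R]_N) (j : 'I_M).

Definition support z theta : R :=
  \sum_j \int[mu]_(s in `[0, theta]) `|switching z j s|.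

Definition bang_bang z : R -> 'cV[R]_M :=
  fun s => \col_j - Num.sg (switching z j s).

Definition extremal z theta : 'cV[R]_N := - steer 0 theta (bang_bang z).

Lemma admissible_on_bang_bang a b z : admissible_on a b (bang_bang z).
Proof.
split=> [j|t _ j]; last by rewrite mxE -ler_norml normrN normr_sg lern1 leq_b1.
apply: (eq_measurable_fun (fun t => - Num.sg (switching z j t))).
  by move=> t _; rewrite mxE.
apply: measurableT_comp => //.
by case: (bounded_measurable_sg (bounded_measurable_switching A B a b z j).1).
Qed.

Lemma bang_bangZ k z s : 0 < k -> bang_bang (k *: z) s = bang_bang z s.
Proof.
by move=> k0; apply/colP => j; rewrite !mxE switchingZ sgrM gtr0_sg// mul1r.
Qed.

Lemma reach_extremal z theta : reach theta (extremal z theta).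
Proof. by exists (bang_bang z) => //; exact: admissible_on_bang_bang. Qed.

Lemma dotv_steer_bang_bang z a b : dotv z (steer a b (bang_bang z)) =
  - \sum_j \int[mu]_(s in `[a, b]) `|switching z j s|.
Proof.
rewrite dotv_steer; last first.
  exact/admissible_on_bounded_measurable/admissible_on_bang_bang.
rewrite -sumrN; apply: eq_bigr => j _.
rewrite -mulN1r -RintegralZl//; last by auto with bounded_measurable.
by apply: eq_Rintegral => s _; rewrite mxE !mulNr mul1r normrEsg.
Qed.

Lemma dotv_extremal z theta : dotv z (extremal z theta) = support z theta.
Proof. by rewrite linearN/= dotv_steer_bang_bang opprK. Qed.

Lemma reach_dotv_le theta x z : reach theta x -> dotv z x <= support z theta.
Proof.
move=> [u au <-]; have bu := admissible_on_bounded_measurable au.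
rewrite linearN/= dotv_steer// -sumrN; apply: ler_sum => j _.
rewrite (le_trans (ler_norm _))// normrN (le_trans (le_normr_Rintegral _ _))//.
  by auto with bounded_measurable.
apply: le_Rintegral => //; [by auto with bounded_measurable..|].
move=> s /=; rewrite in_itv/=; exact: admissible_on_integrand_le.
Qed.

Lemma supportB z theta theta' : 0 <= theta -> theta <= theta' ->
  support z theta' - support z theta =
  \sum_j \int[mu]_(s in `[theta, theta']) `|switching z j s|.
Proof.
move=> th0 thth'; rewrite /support -sumrB; apply: eq_bigr => j _.
rewrite (Rintegral_itv_cat th0 thth'); last by auto with bounded_measurable.
by rewrite addrC addKr.
Qed.

Lemma support_increment_le z theta theta' e : 0 <= theta -> theta <= theta' ->
  (forall j s, theta <= s <= theta' -> `|switching z j s| <= e) ->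
  support z theta' - support z theta <= M%:R * e * (theta' - theta).
Proof.
move=> th0 thth' sw_le; rewrite supportB//.
have -> : M%:R * e * (theta' - theta) = \sum_(j < M) e * (theta' - theta).
  by rewrite sumr_const card_ord -[RHS]mulr_natl mulrA.
apply: ler_sum => j _.
rewrite -(fine_lebesgue_measure_itvcc thth') -Rintegral_cst//.
apply: le_Rintegral => //; [by auto with bounded_measurable..|].
by move=> s /=; rewrite in_itv/=; exact: sw_le.
Qed.

Lemma support_increment_ge z theta theta' (g : 'I_M -> R) : 0 <= theta ->
  theta <= theta' ->
  (forall j s, theta <= s <= theta' -> g j <= `|switching z j s|) ->
  (\sum_j g j) * (theta' - theta) <= support z theta' - support z theta.
Proof.
move=> th0 thth' sw_ge; rewrite supportB// mulr_suml; apply: ler_sum => j _.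
rewrite -(fine_lebesgue_measure_itvcc thth') -Rintegral_cst//.
apply: le_Rintegral => //; [by auto with bounded_measurable..|].
by move=> s /=; rewrite in_itv/=; exact: sw_ge.
Qed.

Lemma support_lipschitz b : exists2 c, 0 <= c & forall z theta theta',
  0 <= theta <= b -> 0 <= theta' <= b ->
  `|support z theta - support z theta'| <= c * `|z| * `|theta - theta'|.
Proof.
have [c c0 cP] := steer_admissible_on_norm_le A B 0 b.
exists (N%:R * c) => [|z theta theta']; first by rewrite mulr_ge0.
wlog thth' : theta theta' / theta' <= theta => [hw|].
  have [|/ltW] := leP theta' theta; first exact: hw.
  by rewrite (distrC (support _ _)) (distrC theta) => thth' ? ?; apply: hw.
move=> /andP[_ thb] /andP[th'0 _]; rewrite supportB//.
rewrite -[\sum_j _]opprK -dotv_steer_bang_bang normrN.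
rewrite (le_trans (dotv_norm_le _ _))// -!mulrA ler_wpM2l// mulrCA ler_wpM2l//.
rewrite (ger0_norm (_ : 0 <= theta - theta')) ?subr_ge0//.
by apply: cP => //; exact: admissible_on_bang_bang.
Qed.

Lemma support_equicontinuous r e : 0 <= r -> 0 < e ->
  \forall s \near r, 0 <= s -> forall z, `|z| <= 1 ->
    `|support z r - support z s| <= e.
Proof.
move=> r0 e0; have [c c0 cP] := support_lipschitz (r + 1); near=> s => s0 z z1.
have r1 : 0 <= r <= r + 1 by rewrite r0 lerDl ler01.
have s1 : 0 <= s <= r + 1.
  have : 1 * `|r - s| <= 1 by near: s; exact: (@near_mul_dist_le _ R^o).
  by rewrite mul1r s0 ler_norml; lra.
rewrite (le_trans (cP z r s r1 s1))//; apply: (@le_trans _ _ (c * `|r - s|)).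
  by rewrite ler_wpM2r// ler_piMr.
by near: s; exact: (@near_mul_dist_le _ R^o).
Unshelve. all: by end_near. Qed.

Lemma support_lipschitz_dir theta : 0 <= theta -> exists2 c, 0 <= c &
  forall z z', support z theta - support z' theta <= c * `|z - z'|.
Proof.
move=> th0; have [c c0 cP] := reach_norm_le A B theta.
exists (N%:R * (c * theta)) => [|z z']; first by rewrite !mulr_ge0.
apply: (@le_trans _ _ (dotv (z - z') (extremal z theta))).
  rewrite dotvBl dotv_extremal lerD2l lerN2.
  exact/reach_dotv_le/reach_extremal.
rewrite (le_trans (ler_norm _))// (le_trans (dotv_norm_le _ _))//.
rewrite mulrAC ler_wpM2r// ler_wpM2l//; apply: cP; first by rewrite th0 lexx.
exact: reach_extremal.
Qed.

Lemma closure_reach_dotv_le theta x z :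
  closure (reach theta) x -> dotv z x <= support z theta.
Proof. by apply: closure_dotv_le => p; exact: reach_dotv_le. Qed.

End SupportFunction.

Section ReachableSetGeometry.
Variables (R : realType) (N M : nat) (A : 'M[R]_N) (B : 'M[R]_(N, M)).
Local Notation mu := (@lebesgue_measure R).
Local Notation switching := (switching A B).
Local Notation steer := (steer A B).
Local Notation reach := (reach A B).
Local Notation support := (support A B).
Local Notation bang_bang := (bang_bang A B).
Local Notation extremal := (extremal A B).
Implicit Types (a b c r s t theta e : R) (x y z p : 'cV[R]_N) (j : 'I_M).

Lemma norm_mul_bang_defect (k g : R) : -1 <= k <= 1 ->
  `|g| * `|k + Num.sg g| = `|g| + k * g.
Proof.
move=> k1; rewrite -normrM; case: (sgrP g) => [->|g0|g0].
- by rewrite mul0r mulr0 normr0 addr0.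
- by rewrite ger0_norm; [ring|nra].
- by rewrite ger0_norm; [ring|nra].
Qed.

Lemma switching_weighted_small r z e :
  (forall j, \rank (kalman A (col j B)) = N) -> z != 0 -> 0 < e ->
  exists2 eta, 0 < eta & forall j w, bounded_measurable `[0, r] w ->
    (forall s, `[0, r]%classic s -> `|w s| <= 2) ->
    \int[mu]_(s in `[0, r]) (`|switching z j s| * `|w s|) <= eta ->
    \int[mu]_(s in `[0, r]) `|w s| <= e.
Proof.
move=> rankAB z0 e0.
have /choice[eta etaP] j : exists eta : R, 0 < eta /\ forall w : R -> R,
    bounded_measurable `[0, r] w -> (forall s, `[0, r]%classic s -> `|w s| <= 2) ->
    \int[mu]_(s in `[0, r]) (`|switching z j s| * `|w s|) <= eta ->
    \int[mu]_(s in `[0, r]) `|w s| <= e.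
  have [||||||eta eta0 etaP] := @Rintegral_norm_small_of_weighted _ _ _ mu `[0, r]
    _ _ (switching z j) 2 e => //.
  - exact: lebesgue_measure_itvcc_lty.
  - exact: bounded_measurable_switching.
  - apply: (@filterS _ _ (ae_filter_ringOfSetsType mu))
      (ae_switching_neq0 (rankAB j) z0) => s sw0 _; exact: sw0.
  by exists eta.
have [d [d0 d_le]] : exists d, 0 < d /\ forall j, d <= eta j.
  have := @filter_ex _ (0 : R)^'+ _; apply; near=> d; split; near: d.
    exact: nbhs_right_gt.
  by apply: filter_forall => j; apply: nbhs_right_le; have [] := etaP j.
exists d => // j w bw w2 int_le.
by apply: (etaP j).2 => //; exact: le_trans (d_le j).
Unshelve. all: by end_near. Qed.

Lemma support_loss z theta (u : R -> 'cV[R]_M) : admissible theta u ->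
  support z theta - dotv z (- steer 0 theta u) =
  \sum_j \int[mu]_(s in `[0, theta])
    (`|switching z j s| * `|(u s - bang_bang z s) j 0|).
Proof.
move=> au; have bu := admissible_on_bounded_measurable au.
rewrite linearN/= opprK dotv_steer// -big_split/=; apply: eq_bigr => j _.
rewrite -RintegralD//; [|by auto with bounded_measurable..].
apply: eq_Rintegral => s; rewrite inE/= in_itv/= => /au.2/(_ j) u1.
by rewrite !mxE opprK norm_mul_bang_defect.
Qed.

Lemma reach_strongly_exposed r z e :
  (forall j, \rank (kalman A (col j B)) = N) -> z != 0 -> 0 < e ->
  exists2 d, 0 < d & forall p, reach r p -> support z r - dotv z p <= d ->
    `|p - extremal z r| <= e.
Proof.
move=> rankAB z0 e0; have [c c0 cP] := steer_norm_le A B 0 r.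
have cM : 0 < c * M%:R + 1 by rewrite ltr_wpDl// mulr_ge0.
have eM0 : 0 < e / (c * M%:R + 1) by rewrite divr_gt0.
have [d d0 dP] := switching_weighted_small r rankAB z0 eM0.
exists d => // p [u au <-]; rewrite support_loss// => loss_le.
have bu := admissible_on_bounded_measurable au.
have bb := admissible_on_bounded_measurable (admissible_on_bang_bang A B 0 r z).
have bdefect := bounded_measurable_cVB (measurable_itv _) bu bb.
have defect_small j :
    \int[mu]_(s in `[0, r]) `|(u s - bang_bang z s) j 0| <= e / (c * M%:R + 1).
  apply: (dP j) => [|s /=|]; first by auto with bounded_measurable.
    rewrite in_itv/= => /au.2/(_ j) u1; rewrite !mxE opprK ler_norml.
    by case: (sgrP (switching z j s)) => _; lra.
  apply: le_trans loss_le; rewrite [leRHS](bigD1 j)//= lerDl.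
  by apply: sumr_ge0 => k _; apply: Rintegral_ge0 => s _; exact: mulr_ge0.
rewrite opprK addrC -opprB -steerB// normrN (le_trans (cP _ _ _ _ _ bdefect))//.
apply: (@le_trans _ _ (c * (M%:R * (e / (c * M%:R + 1))))).
  rewrite ler_wpM2l// (le_trans (ler_sum _ (fun j _ => defect_small j)))//.
  by rewrite sumr_const card_ord mulr_natl.
by rewrite !mulrA ler_pdivrMr// mulrDr mulr1 [e * _]mulrC lerDl ltW.
Qed.

Lemma closure_reach_eq_extremal r z x :
  (forall j, \rank (kalman A (col j B)) = N) -> z != 0 ->
  closure (reach r) x -> support z r <= dotv z x -> x = extremal z r.
Proof.
move=> rankAB z0 rx zx; apply/eqP; rewrite -subr_eq0 -normr_le0.
apply/ler_addgt0Pr => e e0; rewrite add0r.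
have e20 : 0 < e / 2 by rewrite divr_gt0.
have [d d0 dP] := reach_strongly_exposed r rankAB z0 e20.
have [p [rp [xp zp]]] : (reach r `&`
    [set p | `|x - p| < e / 2 /\ support z r - d < dotv z p]) !=set0.
  apply: rx; near=> p; split; near: p.
    by have := nbhsx_ballx x _ e20; rewrite -ball_normE.
  by apply: (cvgr_gt _ (@continuous_dotv _ _ z x)); lra.
rewrite (le_trans (ler_distD p _ _))// (splitr e) lerD ?(ltW xp)//.
by apply: dP => //; lra.
Unshelve. all: by end_near. Qed.

Definition single_input j (f : R -> R) : R -> 'cV[R]_M :=
  fun s => f s *: delta_mx j 0.

Lemma single_inputE j f s k : single_input j f s k 0 = f s * (k == j)%:R.
Proof. by rewrite !mxE eqxx andbT. Qed.

Lemma bounded_measurable_single_input a b j f : bounded_measurable `[a, b] f ->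
  bounded_measurable_cV `[a, b] (single_input j f).
Proof.
move=> bf k; apply: (@eq_bounded_measurable _ _ _ _ (fun s => f s * (k == j)%:R)).
  by move=> s _; rewrite single_inputE.
by auto with bounded_measurable.
Qed.

Lemma dotv_steer_single_input z a b j f : bounded_measurable `[a, b] f ->
  dotv z (steer a b (single_input j f)) =
  \int[mu]_(s in `[a, b]) (f s * switching z j s).
Proof.
move=> bf; rewrite dotv_steer; last exact: bounded_measurable_single_input.
rewrite (bigD1 j)//= [X in _ + X]big1 ?addr0 => [|k kj].
  by apply: eq_Rintegral => s _; rewrite single_inputE eqxx mulr1.
under eq_Rintegral do rewrite single_inputE (negbTE kj) mulr0 mul0r.
by rewrite Rintegral_cst// mul0r.
Qed.

Definition gramian a b j : 'M[R]_N := \matrix_(i, k) \int[mu]_(s in `[a, b])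
  (switching (delta_mx k 0) j s * switching (delta_mx i 0) j s).

Lemma mulmx_gramian a b j y :
  gramian a b j *m y = steer a b (single_input j (switching y j)).
Proof.
apply/colP => i; rewrite coord_dotv [RHS]coord_dotv.
rewrite dotv_steer_single_input; last by auto with bounded_measurable.
rewrite -coord_dotv mxE; under eq_bigr do rewrite mxE mulrC.
transitivity (\sum_k \int[mu]_(s in `[a, b])
    (y k 0 * (switching (delta_mx k 0) j s * switching (delta_mx i 0) j s))).
  by apply: eq_bigr => k _; rewrite RintegralZl//; auto with bounded_measurable.
rewrite -Rintegral_sum//; last by auto with bounded_measurable.
apply: eq_Rintegral => s _; under eq_bigr do rewrite mulrA.
rewrite -mulr_suml; congr (_ * _); apply: eq_bigr => k _.
by rewrite [X in _ = _ * X]coord_dotv.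
Qed.

Lemma gramian_unit a b j : \rank (kalman A (col j B)) = N -> a < b ->
  gramian a b j \in unitmx.
Proof.
move=> rankAb ab; rewrite -unitmx_tr -row_free_unit; apply: inj_row_free => v vW.
apply/eqP/negPn/negP => v0; have z0 : v^T != 0 by rewrite trmx_eq0.
have bsw := bounded_measurable_switching A B a b v^T j.
have /eqP := dotv_steer_single_input v^T j bsw.
rewrite -mulmx_gramian -[gramian a b j]trmxK -trmx_mul vW trmx0 linear0.
have -> : \int[mu]_(s in `[a, b]) (switching v^T j s * switching v^T j s) =
    \int[mu]_(s in `[a, b]) `|switching v^T j s * switching v^T j s|.
  by apply: eq_Rintegral => s _; rewrite -expr2 ger0_norm// sqr_ge0.
rewrite lt_eqF//; apply: Rintegral_norm_gt0 => //.
- exact: lebesgue_measure_itvcc_lty.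
- by auto with bounded_measurable.
- exact: lebesgue_measure_itvcc_gt0.
apply: (@filterS _ _ (ae_filter_ringOfSetsType mu)) (ae_switching_neq0 rankAb z0).
by move=> s sw0 _; rewrite mulf_neq0.
Qed.

Lemma reach_absorb theta e j : \rank (kalman A (col j B)) = N ->
  0 <= theta -> 0 < e -> exists2 d, 0 < d &
  forall x, reach theta x -> ball x d `<=` reach (theta + e).
Proof.
move=> rankAb th0 e0; have th_e : theta < theta + e by rewrite ltrDl.
have unitW := gramian_unit rankAb th_e; set W := gramian _ _ _ in unitW.
have [c c0 cP] := switching_le A B theta (theta + e).
have cW : 0 < c * (N%:R * `|invmx W|) + 1 by rewrite ltr_wpDl// !mulr_ge0.
exists (c * (N%:R * `|invmx W|) + 1)^-1; first by rewrite invr_gt0.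
move=> x rx x'; rewrite -ball_normE /= => xx'.
pose y := invmx W *m (x - x').
have -> : x' = x - steer theta (theta + e) (single_input j (switching y j)).
  by rewrite -mulmx_gramian -/W /y mulKVmx// opprB addrC subrK.
apply: reach_cat => //; first exact: ltW.
split=> [k|s ths k].
  by case: (bounded_measurable_single_input j
    (bounded_measurable_switching A B theta (theta + e) y j) k).
rewrite single_inputE -ler_norml normrM.
have sw1 : `|switching y j s| <= 1.
  rewrite (le_trans (cP _ _ _ ths))// (le_trans (ler_wpM2l c0 (mulmx_norm_le _ _)))//.
  rewrite mulrA (le_trans (ler_wpM2l _ (ltW xx')))//; first by rewrite !mulr_ge0.
  by rewrite ler_pdivrMr// mul1r lerDl.
by case: (k == j); rewrite ?normr1 ?mulr1 ?normr0 ?mulr0.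
Qed.

End ReachableSetGeometry.

Section MinimumTime.
Variables (R : realType) (N M : nat) (A : 'M[R]_N) (B : 'M[R]_(N, M)).
Local Notation reach := (reach A B).
Local Notation support := (support A B).
Local Notation T := (min_time A B).
Implicit Types (r t theta e : R) (x y z p : 'cV[R]_N).

Lemma min_time_ge0 x : (0 <= T x)%E.
Proof. by apply: le_ereal_inf_tmp => _ [t [t0 _] <-]; rewrite lee_fin. Qed.

Lemma min_time_le theta x : 0 <= theta -> reach theta x -> (T x <= theta%:E)%E.
Proof.
move=> th0 [u au xE]; apply: ereal_inf_lbound; exists theta => //; split=> //.
by exists u; split=> //; exact/fwd_sol_eq0.
Qed.

Lemma min_time_lt_reach theta x : (T x < theta%:E)%E -> reach theta x.
Proof.
move=> /ereal_inf_lt[_ [t [t0 [u [au xE]]] <-]]; rewrite lte_fin => t_th.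
apply: (reach_mono t0 (ltW t_th)); exists u => //.
by move/(fwd_sol_eq0 A B x au): xE => ->.
Qed.

Lemma fin_num_min_time x : (T x < +oo)%E -> T x \is a fin_num.
Proof. by move=> Tx; rewrite ge0_fin_numE// min_time_ge0. Qed.

Lemma min_time_le_closure theta x : 0 <= theta ->
  (T x <= theta%:E)%E -> closure (reach theta) x.
Proof.
move=> th0 Tx; apply/closure_normP => e e0.
have [c c0 cP] := steer_admissible_on_norm_le A B 0 (theta + 1).
have c1 : 0 < c + 1 by rewrite ltr_wpDl.
pose h := Num.min 1 (e / (c + 1)).
have h0 : 0 < h by rewrite lt_min ltr01 divr_gt0.
have h1 : h <= 1 by rewrite ge_min lexx.
have ch : c * h < e.
  have : h <= e / (c + 1) by rewrite ge_min lexx orbT.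
  by rewrite ler_pdivlMr//; nra.
have th_h : theta <= theta + h by rewrite lerDl ltW.
have rx : reach (theta + h) x.
  by apply: min_time_lt_reach; apply: le_lt_trans Tx _; rewrite lte_fin ltrDl.
have [p [v [rp av ->]]] := reach_split th0 th_h rx; exists p => //.
rewrite addrAC subrr add0r normrN; apply: le_lt_trans ch.
by have := cP _ _ _ th0 th_h _ av; rewrite lerD2l addrAC subrr add0r; exact.
Qed.

Section Controllable.
Variable j : 'I_M.
Hypothesis rankAb : \rank (kalman A (col j B)) = N.

Lemma min_time_le_closureP theta x : 0 <= theta ->
  (T x <= theta%:E)%E <-> closure (reach theta) x.
Proof.
move=> th0; split; first exact: min_time_le_closure.
move=> /closure_normP cl_x; apply/lee_addgt0Pr => e e0.
have [d d0 dP] := reach_absorb rankAb th0 e0.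
have [p rp xp] := cl_x d d0; apply: min_time_le; first by rewrite addr_ge0// ltW.
by apply: (dP p rp); rewrite -ball_normE /= distrC.
Qed.

Lemma near_min_time_le theta x e : 0 <= theta -> 0 < e -> (T x <= theta%:E)%E ->
  \forall y \near x, (T y <= (theta + e)%:E)%E.
Proof.
move=> th0 e0 /(min_time_le_closure th0)/closure_normP cl_x.
have [d d0 dP] := reach_absorb rankAb th0 e0.
have d20 : 0 < d / 2 by rewrite divr_gt0.
have [p rp xp] := cl_x _ d20; apply: filterS (nbhsx_ballx x _ d20) => y.
rewrite -ball_normE /= => xy; apply: min_time_le; first by rewrite addr_ge0// ltW.
apply: (dP p rp); rewrite -ball_normE /= (le_lt_trans (ler_distD x _ _))//.
by rewrite (splitr d) ltrD// distrC.
Qed.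

Lemma near_min_time_gt theta x : (theta%:E < T x)%E ->
  \forall y \near x, (theta%:E < T y)%E.
Proof.
have [th0 Tx|th0 _] := leP 0 theta; last first.
  by near=> y; apply: lt_le_trans (min_time_ge0 y); rewrite lte_fin.
have : nbhs x (~` closure (reach theta)).
  apply: open_nbhs_nbhs; split; first exact/closed_openC/closed_closure.
  by move=> /(min_time_le_closureP _ th0); rewrite leNgt Tx.
apply: filterS => y y_notin; rewrite ltNge; apply/negP => Ty.
exact/y_notin/(min_time_le_closureP _ th0).
Unshelve. all: by end_near. Qed.

Lemma continuous_min_time x : T x \is a fin_num -> {for x, continuous T}.
Proof.
move=> Tx_fin; have Tx := fineK Tx_fin; set r := fine (T x) in Tx.
have r0 : 0 <= r by rewrite -lee_fin Tx min_time_ge0.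
suff : T @ x --> r%:E by rewrite Tx.
apply/(@fine_cvgP _ _ (nbhs x)); split.
  near=> y; apply: fin_num_min_time; apply: (@le_lt_trans _ _ (r + 1)%:E).
    near: y; apply: near_min_time_le => //; by rewrite Tx.
  exact: ltry.
apply/(@cvgrPdist_le _ _ _ (nbhs x)) => e e0; near=> y.
have Ty_le : (T y <= (r + e)%:E)%E.
  by near: y; apply: near_min_time_le => //; rewrite Tx.
have Ty_gt : ((r - e)%:E < T y)%E.
  by near: y; apply: near_min_time_gt; rewrite -Tx lte_fin gtrBl.
have Ty := fineK (fin_num_min_time (le_lt_trans Ty_le (ltry _))).
by rewrite -Ty !(lte_fin, lee_fin) in Ty_le Ty_gt; rewrite /= ler_distlC; lra.
Unshelve. all: by end_near. Qed.

Lemma min_time_separation theta y : 0 <= theta -> (theta%:E < T y)%E ->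
  exists2 z, `|z| = 1 & support z theta <= dotv z y.
Proof.
move=> th0 Ty; have [c c0 cP] := reach_norm_le A B theta.
have y_notin : ~ closure (reach theta) y.
  by move=> /(min_time_le_closureP _ th0); rewrite leNgt Ty.
have bnd : bounded_set (reach theta).
  exists (c * theta); split=> [|C cC p /(cP theta)]; first exact: num_real.
  by rewrite th0 lexx => /(_ isT)/le_trans; apply; exact: ltW.
have reach0 : reach theta !=set0.
  by exists (extremal A B 0 theta); exact: reach_extremal.
have [v v0 vP] :=
  convex_separation (@reach_convex _ _ _ A B theta) bnd reach0 y_notin.
have nv : 0 < `|v| by rewrite normr_gt0.
exists (`|v|^-1 *: v).
  by rewrite normrZ ger0_norm ?invr_ge0// mulVf// gt_eqF.
rewrite -dotv_extremal !dotvZl ler_pM2l ?invr_gt0//.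
by apply: vP; exact: reach_extremal.
Qed.

End Controllable.

Lemma min_time_neq0 x : x != 0 -> T x != 0%E.
Proof.
apply: contra_neq => Tx; apply/eqP; rewrite -normr_le0.
have [c c0 cP] := reach_norm_le A B 0.
have : closure (reach 0) x by apply: min_time_le_closure; rewrite ?Tx.
move=> /closure_normP cl_x; apply/ler_addgt0Pr => e e0; rewrite add0r.
have [p rp xp] := cl_x e e0.
have : `|p| <= c * 0 by apply: cP => //; rewrite lexx.
rewrite mulr0 normr_le0 => /eqP p0; move: xp; rewrite p0 subr0; exact: ltW.
Qed.

End MinimumTime.

Section ReversedDynamics.
Variables (R : realType) (N M : nat) (A : 'M[R]_N) (B : 'M[R]_(N, M)).
Local Notation mu := (@lebesgue_measure R).
Local Notation switching := (switching A B).
Local Notation steer := (steer A B).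
Local Notation bang_bang := (bang_bang A B).
Local Notation extremal := (extremal A B).
Local Notation rev_sol := (rev_sol A B).
Implicit Types (r s t theta : R) (x y z zeta : 'cV[R]_N) (j : 'I_M).
Implicit Types (u v : R -> 'cV[R]_M).

Lemma switching_tr_expm z j r s :
  switching ((expm A r)^T *m z) j s = switching z j (s - r).
Proof. by rewrite /switching -dotv_mulmx mulmxA -expmD opprB. Qed.

Lemma bang_bang_tr_expm z r s :
  bang_bang ((expm A r)^T *m z) s = bang_bang z (s - r).
Proof. by apply/colP => j; rewrite !mxE switching_tr_expm. Qed.

Lemma bounded_measurable_rev_sol u t : bounded_measurable_cV `[0, t] u ->
  bounded_measurable_cV `[0, t] (fun s => expm A (s - t) *m (B *m u s)).
Proof.
move=> bu; apply: bounded_measurable_cV_dotvP => z.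
apply: (@eq_bounded_measurable _ _ _ _
    (fun s => \sum_j u s j 0 * switching z j (t - s))).
  by move=> s _; rewrite -dotv_expm_cols opprB.
apply: bounded_measurable_sum => // j; apply: bounded_measurableM => //.
exact/bounded_measurable_reflection/bounded_measurable_switching.
Qed.

Lemma eq_rev_sol u v t : {in `[0, t], u =1 v} -> rev_sol u t = rev_sol v t.
Proof. by move=> uv; congr (- _); apply: eq_vint => s /uv ->. Qed.

Lemma ae_eq_rev_sol u v t :
  bounded_measurable_cV `[0, t] u -> bounded_measurable_cV `[0, t] v ->
  {ae mu, forall s, s \in `[0, t] -> u s = v s} -> rev_sol u t = rev_sol v t.
Proof.
move=> bu bv uv; congr (- _); apply: ae_eq_vint.
- exact: bounded_measurable_rev_sol.
- exact: bounded_measurable_rev_sol.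
- by apply: (@filterS _ _ (ae_filter_ringOfSetsType mu)) uv => s uv /uv ->.
Qed.

Lemma rev_solE u t : bounded_measurable_cV `[0, t] u ->
  rev_sol u t = - steer 0 t (fun s => u (t - s)).
Proof.
move=> bu; congr (- _); apply/colP => i; rewrite !mxE Rintegral_reflection.
  by apply: eq_Rintegral => s _; rewrite addrAC subrr add0r.
by have [] := bounded_measurable_rev_sol bu i.
Qed.

Lemma bounded_measurable_rev_bang_bang zeta t :
  bounded_measurable_cV `[0, t] (fun s => bang_bang zeta (- s)).
Proof.
have bsw z j : bounded_measurable `[0, t] (fun s => switching z j (- s)).
  apply: eq_bounded_measurable (continuous_bounded_measurable 0 t
    (@continuous_dotv_expm _ _ A z (col j B))) => s _.
  by rewrite /switching opprK.
move=> j; apply: (@eq_bounded_measurable _ _ _ _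
    (fun s => - Num.sg (switching zeta j (- s)))).
  by move=> s _; rewrite mxE.
by apply: bounded_measurableN; apply: bounded_measurable_sg (bsw zeta j).1.
Qed.

Lemma rev_sol_bang_bang zeta t :
  rev_sol (fun s => bang_bang zeta (- s)) t = extremal ((expm A t)^T *m zeta) t.
Proof.
have steerE : steer 0 t (fun s => bang_bang zeta (- (t - s))) =
    steer 0 t (bang_bang ((expm A t)^T *m zeta)).
  by apply: eq_steer => s _; rewrite opprB bang_bang_tr_expm.
rewrite rev_solE; last exact: bounded_measurable_rev_bang_bang.
by rewrite steerE.
Qed.

(* The minus sign of the reversed dynamics and that of the bang-bang control
   cancel. *)
Lemma sum_vint_rev_sol zeta r :
  \sum_(i < M) vint 0 r (fun t => Num.sg (dotv zeta (expm A t *m col i B)) *: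
    (expm A (t - r) *m col i B)) = rev_sol (fun t => bang_bang zeta (- t)) r.
Proof.
have bF i : bounded_measurable_cV `[0, r] (fun t =>
    Num.sg (dotv zeta (expm A t *m col i B)) *: (expm A (t - r) *m col i B)).
  apply: bounded_measurable_cV_dotvP => z.
  apply: (@eq_bounded_measurable _ _ _ _
      (fun t => - bang_bang zeta (- t) i 0 * switching z i (r - t))).
    by move=> t _; rewrite dotvZr mxE opprK /switching opprK opprB.
  apply: bounded_measurableM => //.
    apply: bounded_measurableN; exact: bounded_measurable_rev_bang_bang.
  exact/bounded_measurable_reflection/bounded_measurable_switching.
have brev := bounded_measurable_rev_sol (bounded_measurable_rev_bang_bang zeta r).
apply: dotv_inj => z; rewrite linear_sum linearN/= dotv_vint//.
under eq_bigr do rewrite dotv_vint//.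
rewrite -Rintegral_sum//; last by auto with bounded_measurable.
rewrite -[RHS]mulN1r -RintegralZl//; last first.
  exact/bounded_measurable_integrable_itv/bounded_measurable_dotv.
apply: eq_Rintegral => s _.
rewrite [in RHS]mulN1r -[in RHS](opprB r s) [in RHS]dotv_expm_cols -[RHS]sumrN.
by apply: eq_bigr => i _; rewrite dotvZr mxE mulNr opprK /switching opprK opprB.
Qed.

Lemma setSP x : setS A B x <-> exists r zeta, [/\ 0 < r, zeta != 0,
  x = rev_sol (fun t => bang_bang zeta (- t)) r &
  forall i, dotv zeta (col i B) = 0].
Proof.
split=> [[r [zeta [r0 [zeta1 [-> zetaB]]]]]|[r [zeta [r0 zeta0 -> zetaB]]]].
  exists r, zeta; split=> //; last exact: sum_vint_rev_sol.
  by apply/eqP => zeta0; move/eqP: zeta1; rewrite zeta0 linear0 eq_sym oner_eq0.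
have norm0 := dotv_gt0 zeta0; set k := dotv zeta zeta in norm0.
have k0 : 0 < (Num.sqrt k)^-1 by rewrite invr_gt0 sqrtr_gt0.
exists r, ((Num.sqrt k)^-1 *: zeta); split=> //; split; [|split].
- rewrite dotvZl dotvZr -/k mulrA -invfM -expr2 sqr_sqrtr ?ltW//.
  by rewrite mulVf// gt_eqF.
- by rewrite sum_vint_rev_sol; apply: eq_rev_sol => s _; rewrite bang_bangZ.
- by move=> i; rewrite dotvZl zetaB mulr0.
Qed.

Lemma setS_extremalP x : setS A B x <-> exists r z, [/\ 0 < r, z != 0,
  x = extremal z r & forall j, switching z j r = 0].
Proof.
rewrite setSP; split=> -[r [z [r0 z0 -> zB]]].
  exists r, ((expm A r)^T *m z); rewrite rev_sol_bang_bang mulmx_tr_expm_eq0.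
  by split=> // j; rewrite switching_tr_expm subrr /switching oppr0 expm0 mul1mx.
exists r, ((expm A (- r))^T *m z).
rewrite rev_sol_bang_bang mulmx_tr_expm_eq0 mulmxA -trmx_mul expmKN trmx1 mul1mx.
by split=> // j; rewrite -dotv_mulmx; exact: zB.
Qed.

End ReversedDynamics.

Section NonLipschitzPoints.
Variables (R : realType) (n : nat).
Implicit Types (f : 'cV[R]_n -> \bar R) (x y v p q : 'cV[R]_n).

Lemma infinite_slope_non_lipschitz f x v : f x \is a fin_num -> v != 0 ->
  (forall k, 0 < k ->
    \forall h \near 0^'+, (f x + (k * h)%:E <= f (x + h *: v)%R)%E) ->
  non_lipschitz_at f x.
Proof.
move=> fx_fin v0 slope; have nv : 0 < `|v| by rewrite normr_gt0.
pose h (i : nat) : R := i.+1%:R^-1; have h0 i : 0 < h i by rewrite invr_gt0.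
exists (cst x), (fun i => x + h i *: v); split; first exact: cvg_cst.
split.
  rewrite -[X in _ --> X]addr0; apply: cvgD; first exact: cvg_cst.
  rewrite -[X in _ --> X](scale0r v); apply: cvgZr_tmp; exact: cvg_harmonic.
split=> [i|].
  by rewrite eq_sym -subr_eq0 addrAC subrr add0r scaler_eq0 (negbTE v0) gt_eqF.
apply: (cvg_limn_einf_sup _).2; apply/cvgeyPger => K _.
have k0 : 0 < (`|K| + 1) * `|v| by rewrite mulr_gt0// ltr_wpDl.
have slopeK : \forall i \near \oo, 0 < h i ->
    (f x + ((`|K| + 1) * `|v| * h i)%:E <= f (x + h i *: v)%R)%E.
  exact: cvg_harmonic (slope _ k0).
near=> i.
have slope_i : (f x + ((`|K| + 1) * `|v| * h i)%:E <= f (x + h i *: v)%R)%E.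
  by apply: (near slopeK i).
have hv0 : 0 < h i * `|v| by rewrite mulr_gt0.
have -> : `|x + h i *: v - x| = h i * `|v|.
  by rewrite addrAC subrr add0r normrZ gtr0_norm.
rewrite -(fineK fx_fin) in slope_i *; set a := fine (f x) in slope_i *.
apply: (@le_trans _ _ (((`|K| + 1) * `|v| * h i)%:E * ((h i * `|v|)^-1)%:E)%E).
  rewrite -EFinM lee_fin -mulrA (mulrC `|v|) mulfK ?gt_eqF//.
  by rewrite (le_trans (ler_norm _))// lerDl.
rewrite lee_wpmul2r//; first by rewrite lee_fin invr_ge0 ltW.
case: (f (x + h i *: v)) slope_i => [b| |]//=; rewrite ?leey// !lee_fin => slope_i.
by rewrite (le_trans _ (ler_norm _))//; lra.
Unshelve. all: by end_near. Qed.

Lemma non_lipschitz_at_steep f x : non_lipschitz_at f x ->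
  (\forall y \near x, f y \is a fin_num) -> forall k (U : set 'cV[R]_n),
  0 <= k -> nbhs x U ->
  exists p q, [/\ U p, U q & k * `|p - q| < fine (f p) - fine (f q)].
Proof.
move=> [xs [ys [xsx [ysx [neq_xy limxy]]]]] f_fin k U k0 xU.
pose V := [set i | (U (xs i) /\ f (xs i) \is a fin_num) /\
                   (U (ys i) /\ f (ys i) \is a fin_num)].
have nV : \forall i \near \oo, V i.
  have Ufin : nbhs x (U `&` [set y | f y \is a fin_num]) by exact: filterI.
  by apply: filterI; [exact: xsx Ufin|exact: ysx Ufin].
have [i [[Ux fx_fin] [Uy fy_fin]] steep] : exists2 i, V i &
    (k%:E < `|f (ys i) - f (xs i)| * (`|ys i - xs i|^-1)%:E)%E.
  have : (k%:E < ereal_sup [set (`|f (ys i) - f (xs i)| *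
      (`|ys i - xs i|^-1)%:E)%E | i in V])%E.
    apply: (@lt_le_trans _ _ +oo%E); first exact: ltry.
    by rewrite -limxy; apply: ereal_inf_lbound; exists V.
  by move=> /ereal_sup_gt[_ [i Vi <-] steep]; exists i.
have dxy : 0 < `|ys i - xs i| by rewrite normr_gt0 subr_eq0 eq_sym.
rewrite -(fineK fx_fin) -(fineK fy_fin) -EFinB abse_EFin -EFinM lte_fin in steep.
rewrite ltr_pdivlMr// in steep; move: steep.
have [fxy|fxy] := leP (fine (f (xs i))) (fine (f (ys i))).
  by rewrite ger0_norm ?subr_ge0//; exists (ys i), (xs i).
by rewrite ltr0_norm ?subr_lt0// opprB distrC; exists (xs i), (ys i).
Qed.

End NonLipschitzPoints.

Section LipschitzCharacterization.
Variables (R : realType) (N M : nat) (A : 'M[R]_N) (B : 'M[R]_(N, M)).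
Local Notation switching := (switching A B).
Local Notation reach := (reach A B).
Local Notation support := (support A B).
Local Notation extremal := (extremal A B).
Local Notation T := (min_time A B).
Implicit Types (r s t theta e k h : R) (x y z p q : 'cV[R]_N) (j : 'I_M).

Lemma near_not_reach z r k : 0 <= r -> z != 0 ->
  (forall j, switching z j r = 0) -> 0 < k ->
  \forall h \near 0^'+, ~ reach (r + k * h) (extremal z r + h *: z).
Proof.
move=> r0 z0 sw0 k0; have zz := dotv_gt0 z0.
have kM : 0 < k * M%:R + 1 by rewrite ltr_wpDl// mulr_ge0// ltW.
pose eta := dotv z z / (k * M%:R + 1) / 2.
have eta0 : 0 < eta by rewrite !divr_gt0.
have sw_small j : \forall s \near r, `|switching z j s| <= eta.
  have /cvgrPdist_le/(_ _ eta0) := @continuous_switching _ _ _ A B z j r.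
  by apply: filterS => s; rewrite sw0 sub0r normrN.
have [d /= d0 dP] := filter_forall _ sw_small.
near=> h => reach_h.
have h0 : 0 < h by near: h; exact: nbhs_right_gt.
have kh : k * h < d.
  by rewrite -ltr_pdivlMl// mulrC; near: h; apply: nbhs_right_lt; rewrite divr_gt0.
have := reach_dotv_le z reach_h; rewrite linearD/= dotvZr dotv_extremal.
apply/negP; rewrite -ltNge -ltrBlDl.
have rk : r <= r + k * h by rewrite lerDl mulr_ge0// ltW.
have -> : h * dotv z z = eta * 2 * (k * M%:R + 1) * h.
  by rewrite /eta divfK// divfK ?gt_eqF// mulrC.
apply: le_lt_trans (support_increment_le r0 rk _) _.
  move=> j s /andP[rs sr]; apply: dP; rewrite /ball_/= distrC ger0_norm ?subr_ge0//.
  by rewrite (le_lt_trans _ kh)// lerBlDl.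
rewrite addrAC subrr add0r.
have eta_h : 0 < eta * h by rewrite mulr_gt0.
have : 0 <= M%:R * k * (eta * h).
  by rewrite mulr_ge0 ?(ltW eta_h)// mulr_ge0 ?(ltW k0).
lra.
Unshelve. all: by end_near. Qed.

Lemma setS_non_lipschitz x : setS A B x -> non_lipschitz_at T x.
Proof.
move=> /setS_extremalP[r [z [r0 z0 -> sw0]]].
have Tr := min_time_le (ltW r0) (reach_extremal A B z r).
apply: (infinite_slope_non_lipschitz _ z0) => [|k k0].
  exact: fin_num_min_time (le_lt_trans Tr (ltry _)).
have := near_not_reach (ltW r0) z0 sw0 k0; apply: filterS => h not_reach.
apply: (@le_trans _ _ (r + k * h)%:E); first by rewrite EFinD leeD.
by rewrite leNgt; apply/negP => /min_time_lt_reach.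
Qed.

Lemma switching_equicontinuous r e : 0 < e -> \forall s \near r,
  forall z j, `|z| <= 1 -> `|switching z j s - switching z j r| <= e.
Proof.
move=> e0; have expm_close j : \forall s \near r,
    N%:R * `|expm A (- r) *m col j B - expm A (- s) *m col j B| <= e.
  have cvg_col : expm A (- s) *m col j B @[s --> r] --> expm A (- r) *m col j B.
    apply/cvg_mxP => i k; rewrite ord1 coord_dotv.
    by under eq_fun do rewrite coord_dotv; exact: continuous_switching.
  exact: cvg_col (near_mul_dist_le (expm A (- r) *m col j B) (ler0n R N) e0).
apply: filterS (filter_forall _ expm_close) => s s_close z j z1.
rewrite /switching -dotvBr (le_trans (dotv_norm_le _ _))//.
apply: le_trans (s_close j); rewrite distrC ler_wpM2r// -[leRHS]mulr1 ler_wpM2l//.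
Qed.

(* It is nonnegative at [x] when [T x = r], and its zeros [z] are the outward
   normals at [x] of the sublevel set whose switching functions vanish at [r]. *)
Definition normal_defect r x z : R :=
  \sum_j `|switching z j r| + (support z r - dotv z x).

Lemma normal_defect_lipschitz r x : 0 <= r -> exists2 c, 0 <= c &
  forall z z', normal_defect r x z - normal_defect r x z' <= c * `|z - z'|.
Proof.
move=> r0; have [c1 c10 c1P] := switching_le A B 0 r.
have [c2 c20 c2P] := support_lipschitz_dir A B r0.
exists (M%:R * c1 + c2 + N%:R * `|x|) => [|z z'].
  by rewrite !addr_ge0// mulr_ge0.
have sw_lip : \sum_j `|switching z j r| - \sum_j `|switching z' j r| <=
    M%:R * c1 * `|z - z'|.
  have -> : M%:R * c1 * `|z - z'| = \sum_(j < M) c1 * `|z - z'|.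
    by rewrite sumr_const card_ord -[RHS]mulr_natl mulrA.
  rewrite -sumrB; apply: ler_sum => j _.
  by rewrite (le_trans (lerB_dist _ _))// -switchingB c1P// r0 lexx.
have dot_lip : dotv z' x - dotv z x <= N%:R * `|x| * `|z - z'|.
  rewrite -dotvBl (le_trans (ler_norm _))// (le_trans (dotv_norm_le _ _))//.
  by rewrite mulrAC distrC.
by rewrite /normal_defect; have := c2P z z'; lra.
Qed.

Section Controllable.
Variable j0 : 'I_M.
Hypothesis rankAB : forall j, \rank (kalman A (col j B)) = N.

Lemma normal_defect_le x p z r t theta e : 0 <= t -> t < theta -> `|z| <= 1 ->
  (forall j s, t <= s <= theta ->
    `|switching z j s - switching z j r| <= e / M%:R) ->
  `|support z r - support z theta| <= e -> support z theta <= dotv z p ->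
  support z theta - support z t <= e * (theta - t) -> N%:R * `|x - p| <= e ->
  normal_defect r x z <= 4 * e.
Proof.
move=> t0 t_th z1 sw_close supp_close zp supp_incr xp.
have M0 : M%:R != 0 :> R by rewrite pnatr_eq0; case: (M) j0 => // -[].
have sw_sum : \sum_j `|switching z j r| - e <= e.
  have -> : \sum_j `|switching z j r| - e = \sum_j (`|switching z j r| - e / M%:R).
    by rewrite sumrB sumr_const card_ord -[X in _ = _ - X]mulr_natr divfK.
  rewrite -(ler_pM2r (_ : 0 < theta - t)) ?subr_gt0//.
  apply: le_trans (support_increment_ge t0 (ltW t_th) _) supp_incr.
  move=> j s /(sw_close j).
  have := lerB_dist (switching z j r) (switching z j s); rewrite distrC; lra.
have dot_close : dotv z p - dotv z x <= e.
  rewrite -dotvBr (le_trans (ler_norm _))// (le_trans (dotv_norm_le _ _))//.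
  by rewrite distrC (le_trans _ xp)// ler_wpM2r// -[leRHS]mulr1 ler_wpM2l.
have := ler_norm (support z r - support z theta); rewrite /normal_defect; lra.
Qed.

Lemma separating_normal p q t theta : 0 <= t -> t <= theta ->
  (T q < t%:E)%E -> (theta%:E < T p)%E ->
  exists2 z, `|z| = 1 & support z theta <= dotv z p /\
    support z theta - support z t <= N%:R * `|p - q|.
Proof.
move=> t0 t_th Tq Tp.
have [z z1 zp] := min_time_separation (rankAB j0) (le_trans t0 t_th) Tp.
exists z => //; split=> //; have zq := reach_dotv_le z (min_time_lt_reach Tq).
have := dotv_norm_le z (p - q); rewrite z1 mulr1.
by move=> /(le_trans (ler_norm _)); rewrite dotvBr; lra.
Qed.

(* [T] drops from [p] to a nearby [q] at slope at least [N / e]; the times [t]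
   and [theta] cut the interval [T q, T p] into thirds. *)
Lemma steep_normal x r e d (U : set 'cV[R]_N) : T x = r%:E ->
  non_lipschitz_at T x -> 0 < e -> 0 < d -> nbhs x U ->
  exists p t theta, [/\ U p, 0 <= t, t < theta &
    forall s, t <= s <= theta -> ball r d s] /\
    exists2 z, `|z| = 1 & support z theta <= dotv z p /\
      support z theta - support z t <= e * (theta - t).
Proof.
move=> Tx nonlip e0 d0 xU.
have /fine_cvgP[T_fin T_cvg] : T @ x --> r%:E.
  by rewrite -Tx; apply: (continuous_min_time (rankAB j0)); rewrite Tx.
pose V := [set y | [/\ T y \is a fin_num, ball r d (fine (T y)) & U y]].
have xV : nbhs x V.
  near=> y; split; near: y; [exact: T_fin|exact: T_cvg (nbhsx_ballx r d d0)|].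
  exact: xU.
have slope0 : 0 <= 3 * N%:R / e by rewrite divr_ge0 ?mulr_ge0// ltW.
have [p [q [[/fineK Tp rTp Up] [/fineK Tq rTq _]]]] :=
  non_lipschitz_at_steep nonlip T_fin slope0 xV.
have tq0 : 0 <= fine (T q) by rewrite fine_ge0// min_time_ge0.
set tp := fine (T p) in Tp rTp *; set tq := fine (T q) in Tq rTq tq0 * => steep.
have pq0 : 0 <= 3 * N%:R / e * `|p - q| by rewrite mulr_ge0.
pose t := (tp + tq *+ 2) / 3; pose theta := (tp *+ 2 + tq) / 3.
have t0 : 0 <= t by rewrite /t; lra.
have t_th : t < theta by rewrite /t /theta; lra.
exists p, t, theta; split.
  split=> // s; rewrite /t /theta -!ball_normE /= in rTp rTq * => ?.
  by rewrite ltr_norml; rewrite !ltr_norml in rTp rTq; lra.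
have [||z z1 [zp incr_le]] := @separating_normal p q t theta t0 (ltW t_th).
- by rewrite -Tq lte_fin /t; lra.
- by rewrite -Tp lte_fin /theta; lra.
exists z => //; split=> //; apply: le_trans incr_le _.
have := ltW steep; rewrite mulrAC ler_pdivrMr// /theta /t; lra.
Unshelve. all: by end_near. Qed.

Lemma almost_normal x r e : T x = r%:E -> 0 < e -> non_lipschitz_at T x ->
  exists2 z, `|z| = 1 & normal_defect r x z <= e.
Proof.
move=> Tx e0 nonlip; have r0 : 0 <= r by rewrite -lee_fin -Tx min_time_ge0.
have M0 : 0 < M%:R :> R by rewrite ltr0n; case: (M) j0 => // -[].
have e4 : 0 < e / 4 by rewrite divr_gt0.
have eM : 0 < e / 4 / M%:R by rewrite divr_gt0.
have [d /= d0 dP] := filterI (switching_equicontinuous r eM)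
  (support_equicontinuous A B r0 e4).
have x_close : \forall y \near x, N%:R * `|x - y| <= e / 4 :=
  near_mul_dist_le x (ler0n R N) e4.
have [p [t [theta [[xp t0 t_th t_close] [z z1 [zp incr_le]]]]]] :=
  steep_normal Tx nonlip e4 d0 x_close.
exists z => //; have -> : e = 4 * (e / 4) by lra.
apply: (@normal_defect_le x p z r t theta) => //; first by rewrite z1.
  by move=> j s /t_close/dP[+ _]; apply; rewrite z1.
have /dP[_] : ball r d theta by apply: t_close; rewrite lexx ltW.
by apply; rewrite ?z1// (le_trans t0)// ltW.
Qed.

Lemma exact_normal x r : T x = r%:E -> non_lipschitz_at T x ->
  exists z, [/\ z != 0, support z r <= dotv z x & forall j, switching z j r = 0].
Proof.
move=> Tx nonlip; have r0 : 0 <= r by rewrite -lee_fin -Tx min_time_ge0.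
have [c c0 lip] := normal_defect_lipschitz x r0.
have [e e0|z z1 z_le0] := unit_sphere_le0 (lipschitz_le_continuous c0 lip) _.
  exact: almost_normal.
have supp_ge : dotv z x <= support z r.
  by apply: closure_reach_dotv_le; apply: min_time_le_closure; rewrite ?Tx.
have sw_ge0 : 0 <= \sum_j `|switching z j r| by exact: sumr_ge0.
rewrite /normal_defect in z_le0.
exists z; split; [by rewrite -normr_gt0 z1|lra|move=> j; apply/eqP].
rewrite -normr_le0; apply: le_trans (_ : \sum_j `|switching z j r| <= 0); last lra.
by rewrite (bigD1 j)//= lerDl sumr_ge0.
Qed.

Lemma non_lipschitz_setS x : x != 0 -> T x \is a fin_num ->
  non_lipschitz_at T x -> setS A B x.
Proof.
move=> x0 Tx_fin nonlip; have Tx := esym (fineK Tx_fin); set r := fine _ in Tx.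
have [z [z0 zx sw0]] := exact_normal Tx nonlip.
have r0 : 0 < r.
  rewrite lt_def -lee_fin -Tx min_time_ge0 andbT.
  by apply/eqP => rE; have := min_time_neq0 A B x0; rewrite Tx rE eqxx.
apply/setS_extremalP; exists r, z; split=> //.
apply: closure_reach_eq_extremal => //.
by apply: min_time_le_closure; rewrite ?Tx// ltW.
Qed.

End Controllable.
End LipschitzCharacterization.

Section VanishingHamiltonian.
Variables (R : realType) (N M : nat) (A : 'M[R]_N) (B : 'M[R]_(N, M)).
Local Notation mu := (@lebesgue_measure R).
Local Notation bang_bang := (bang_bang A B).
Implicit Types (t theta : R) (z : 'cV[R]_N).

Lemma inf_dotv_cube z :
  inf [set dotv z (B *m w) | w in @cube R M] = - \sum_j `|dotv z (col j B)|.
Proof.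
set S := [set _ | w in _].
have S_lb : lbound S (- \sum_j `|dotv z (col j B)|).
  move=> _ [w w1 <-]; rewrite dotv_mulmx_cols -sumrN; apply: ler_sum => j _.
  rewrite lerNl (le_trans (ler_norm _))// normrN normrM ler_piMl//.
  by rewrite ler_norml; exact: w1.
have S_min : S (- \sum_j `|dotv z (col j B)|).
  exists (\col_j - Num.sg (dotv z (col j B))).
    by move=> j; rewrite mxE -ler_norml normrN normr_sg lern1 leq_b1.
  rewrite dotv_mulmx_cols -sumrN; apply: eq_bigr => j _.
  by rewrite mxE mulNr normrEsg.
apply/eqP; rewrite eq_le ge_inf//=; last by exists (- \sum_j `|dotv z (col j B)|).
by apply: lb_le_inf => //; exists (- \sum_j `|dotv z (col j B)|).
Qed.

Lemma dotv_eq_inf_cube z (w : 'cV[R]_M) : cube w ->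
  dotv z (B *m w) = inf [set dotv z (B *m w) | w in @cube R M] ->
  forall j, dotv z (col j B) != 0 -> w j 0 = - Num.sg (dotv z (col j B)).
Proof.
rewrite inf_dotv_cube dotv_mulmx_cols => w1 /eqP.
rewrite -subr_eq0 opprK -big_split/=.
under eq_bigr do rewrite addrC -norm_mul_bang_defect//.
rewrite psumr_eq0 => [/allP defect0 j zj|j _]; last exact: mulr_ge0.
have := defect0 j (mem_index_enum _).
by rewrite mulf_eq0 !normr_eq0 (negbTE zj) addr_eq0 => /eqP.
Qed.

Lemma rev_sol0 u : rev_sol A B u 0 = 0.
Proof. by apply/colP => i; rewrite !mxE set_itv1 Rintegral_set1 oppr0. Qed.

Lemma vanishing_hamiltonian_setS theta u :
  (forall j, \rank (kalman A (col j B)) = N) ->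
  admissible theta u -> vanishing_hamiltonian A B theta u ->
  forall t, 0 < t <= theta -> setS A B (rev_sol A B u t).
Proof.
move=> rankAB au [nu [nu0 [_ [u_min ham0]]]] t /andP[t0 t_th].
have th0 : 0 <= theta by rewrite (le_trans _ t_th)// ltW.
pose zeta := (expm A (- theta))^T *m nu.
have lambdaE s : expm A^T (s - theta) *m nu = (expm A s)^T *m zeta.
  by rewrite trmx_expm mulmxA -trmx_mul -expmD addrC.
have zeta0 : zeta != 0 by rewrite mulmx_tr_expm_eq0.
apply/setSP; exists t, zeta; split=> //; last first.
  move=> i; have := ham0 0; rewrite lexx th0 => /(_ isT).
  rewrite /ham_min rev_sol0 mulmx0 linear0 add0r inf_dotv_cube lambdaE.
  rewrite expm0 trmx1 mul1mx => /eqP; rewrite oppr_eq0 psumr_eq0 => [/allP b0|j _//].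
  by apply/eqP; rewrite -normr_eq0; exact: b0 (mem_index_enum _).
have ae_sw_neq0 : {ae mu, forall s, forall j, dotv zeta (expm A s *m col j B) != 0}.
  apply: (@filter_forall _ _ _ _ (ae_filter_ringOfSetsType mu)) => j.
  apply: (@filterS _ _ (ae_filter_ringOfSetsType mu))
    (ae_notin_countable (countable_zeros_dotv_expm (rankAB j) zeta0)).
  by move=> s /eqP.
apply: ae_eq_rev_sol; [|exact: bounded_measurable_rev_bang_bang|].
  exact/admissible_on_bounded_measurable/(admissible_onS (lexx 0) t_th au).
apply: (@filterS2 _ _ (ae_filter_ringOfSetsType mu)) u_min ae_sw_neq0.
move=> s u_min sw_neq0; rewrite in_itv/= => /andP[s0 st].
have s_th : 0 <= s <= theta by rewrite s0 (le_trans st).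
have cube_u : cube (u s) by move=> j; exact: au.2.
apply/colP => j; rewrite mxE /switching opprK dotv_mulmx -lambdaE.
apply: (dotv_eq_inf_cube cube_u (u_min s_th)).
by rewrite lambdaE -dotv_mulmx.
Qed.

End VanishingHamiltonian.

Theorem theorem4p4 (R : realType) (N M : nat)
  (A : 'M[R]_N) (B : 'M[R]_(N, M)) :
  (1 <= M)%N -> (M <= N)%N -> (2 <= N)%N ->
  (forall i : 'I_M, \rank (kalman A (col i B)) = N) ->
  (\rank B < N)%N ->
  (forall xbar : 'cV[R]_N, xbar != 0 -> (min_time A B xbar < +oo)%E ->
     (non_lipschitz_at (min_time A B) xbar <-> setS A B xbar)) /\
  (forall (theta : R) (u : R -> 'cV[R]_M),
     rev_optimal A B theta u -> vanishing_hamiltonian A B theta u ->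
     forall t0 t, 0 <= t0 -> t0 <= t -> t <= theta ->
       setS A B (rev_sol A B u t0) -> setS A B (rev_sol A B u t)).
Proof.
move=> M_gt0 _ _ rankAB _; split=> [x x0 Tx|theta u [_ [au _]] vanish].
  split; last exact: setS_non_lipschitz.
  by apply: (non_lipschitz_setS (Ordinal M_gt0)) => //; exact: fin_num_min_time.
move=> t0 t t0_ge0; rewrite le_eqVlt => /predU1P[<-//|t0t t_th _].
by apply: (vanishing_hamiltonian_setS rankAB au vanish); rewrite (le_lt_trans t0_ge0).
Qed.
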